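(* Let $(k(N))_{N\in\mathbb{N}}$ be any sequence of positive integers with $k(N)\le N$ such that $$\lim_{N\to\infty} k(N)=+\infty,\qquad \lim_{N\to\infty}\frac{k(N)}{N}=\alpha\in[0,1].$$ (1) If $h=0$ and $\beta\in(0,1)$, then $$\lim_{N\to\infty} d_{TV}\left(\mu_N\circ \mathcal{P}_{k(N)}^{-1},\ \mathrm{Bin}(k(N),1/2)\right)=D\left(\frac{1-\beta+\alpha\beta}{4(1-\beta)},\frac14\right).$$ (2) If $h=0$ and $\beta>1$, then, with $m=m(\beta,0)$, $$\lim_{N\to\infty} d_{TV}\left(\mu_N\circ \mathcal{P}_{k(N)}^{-1},\ \mathrm{Bin}\left(k(N),\tfrac12\left(\delta_{(1+m)/2}+\delta_{(1-m)/2}\right)\right)\right)=D\left(\frac{1-m^2}{4}\left(1+\frac{\alpha\beta(1-m^2)}{1-\beta(1-m^2)}\right),\frac{1-m^2}{4}\right).$$ (3) If $h\neq0$ and $\beta>0$, then, with $m=m(\beta,h)$, $$\lim_{N\to\infty} d_{TV}\left(\mu_N\circ \mathcal{P}_{k(N)}^{-1},\ \mathrm{Bin}\left(k(N),\tfrac{1+m}{2}\right)\right)=D\left(\frac{1-m^2}{4}\left(1+\frac{\alpha\beta(1-m^2)}{1-\beta(1-m^2)}\right),\frac{1-m^2}{4}\right).$$ In particular, if $k(N)=o(N)$, then $\alpha=0$ and the right-hand sides in (1), (2) and (3) vanish.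
   Context: For $\beta>0$, $h\in\mathbb{R}$ and $N\in\mathbb{N}$, the Curie-Weiss Gibbs measure $\mu_N=\mu_{N,\beta,h}$ is the probability measure on $\{-1,+1\}^N$ given by $$\mu_N(\sigma)=\frac{1}{Z_N}\exp\left(\frac{\beta}{2N}\sum_{i,j=1}^N\sigma_i\sigma_j+h\sum_{i=1}^N\sigma_i\right),$$ where $Z_N=Z_N(\beta,h)$ is the normalizing constant. For $1\le k\le N$, $\mathcal{P}_k=\mathcal{P}_k(\sigma)=|\{j\in\{1,\dots,k\}:\sigma_j=+1\}|$, and $\mu_N\circ\mathcal{P}_k^{-1}$ is its distribution under $\mu_N$. $m(\beta,h)$ denotes the solution $z$ of $z=\tanh(\beta z+h)$ that is largest in absolute value: it is unique and positive if $h>0$, unique and negative if $h<0$, equal to $0$ if $h=0$ and $0<\beta\le1$; if $h=0$ and $\beta>1$ there are two non-zero solutions $\pm m(\beta,0)$ and $m(\beta,0)$ denotes the positive one. One has $0<\beta(1-m(\beta,h)^2)<1$ for all $(\beta,h)\ne(1,0)$. $\mathrm{Bin}(n,p)$ is the binomial distribution. For a probability distribution $\nu$ on $[0,1]$, $\mathrm{Bin}(n,\nu)$ is the mixed binomial distribution $\mathrm{Bin}(n,\nu)(\{j\})=\int_{[0,1]}\binom nj x^j(1-x)^{n-j}\,\nu(dx)$, $0\le j\le n$. $\delta_x$ is the Dirac measure at $x$. The total variation distance is $d_{TV}(\mathfrak{M}_1,\mathfrak{M}_2)=\sup_{A\in\mathcal{B}(\mathbb{R})}|\mathfrak{M}_1(A)-\mathfrak{M}_2(A)|$.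 For $v_1^2,v_2^2>0$, $$D(v_1^2,v_2^2)=\frac12\int_{\mathbb{R}}\left|\varphi(t;0,v_1^2)-\varphi(t;0,v_2^2)\right|dt,\qquad \varphi(t;a,v^2)=\frac{1}{v\sqrt{2\pi}}\exp\left(-\frac{(t-a)^2}{2v^2}\right)\ (v=\sqrt{v^2}>0).$$ *)

(* Defs.v *)
From HB Require Import structures.
From mathcomp Require Import all_boot all_order all_algebra.
From mathcomp Require Import all_classical all_reals all_analysis.
From mathcomp Require Import ring.

Set Implicit Arguments.
Unset Strict Implicit.
Unset Printing Implicit Defensive.

Import Order.TTheory GRing.Theory Num.Theory.
Import numFieldNormedType.Exports.

Local Open Scope classical_set_scope.
Local Open Scope ring_scope.

(* Spin configurations in {-1, +1}^N: [true] encodes the spin +1 and [false]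
   the spin -1. Sites are numbered from 0. *)
Definition config (N : nat) := {ffun 'I_N -> bool}.

HB.instance Definition _ (N : nat) := Finite.on (config N).
HB.instance Definition _ (N : nat) :=
  isPointed.Build (config N) [ffun=> true].
HB.instance Definition _ (N : nat) :=
  @isMeasurable.Build default_measure_display (config N)
    discrete_measurable discrete_measurable0
    discrete_measurableC discrete_measurableU.

Section curie_weiss.
Context {R : realType}.

Definition spin (N : nat) (s : config N) (i : 'I_N) : R :=
  if s i then 1 else -1.

Definition gibbs_weight (N : nat) (beta h : R) (s : config N) : R :=
  expR (beta / (2 * N%:R) * (\sum_(i < N) \sum_(j < N) spin s i * spin s j)
        + h * \sum_(i < N) spin s i).

Definition partition_function (N : nat) (beta h : R) : R :=
  \sum_(s : config N) gibbs_weight beta h s.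

Definition gibbs (N : nat) (beta h : R) : set (config N) -> \bar R :=
  fun U => (\esum_(s in U)
    (gibbs_weight beta h s / partition_function N beta h)%:E)%E.

Section gibbs_probability.
Variables (N : nat) (beta h : R).

Lemma gibbs_weight_gt0 (s : config N) : 0 < gibbs_weight beta h s.
Proof. exact: expR_gt0. Qed.

Lemma partition_function_gt0 : 0 < partition_function N beta h.
Proof.
rewrite /partition_function (bigD1 (point : config N))//=.
rewrite ltr_pwDl ?gibbs_weight_gt0//.
by apply: sumr_ge0 => s _; exact/ltW/gibbs_weight_gt0.
Qed.

Let mass_ge0 (s : config N) :
  (0 <= (gibbs_weight beta h s / partition_function N beta h)%:E)%E.
Proof.
by rewrite lee_fin divr_ge0// ltW// ?gibbs_weight_gt0 ?partition_function_gt0.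
Qed.

Let gibbs0 : gibbs beta h (@set0 (config N)) = 0%E.
Proof. exact: esum_set0. Qed.

Let gibbs_ge0 (U : set (config N)) : (0 <= gibbs beta h U)%E.
Proof. by apply: esum_ge0 => s _. Qed.

Let gibbs_sigma_additive :
  semi_sigma_additive (gibbs beta h : set (config N) -> \bar R).
Proof.
move=> F mF tF mUF; rewrite /gibbs; apply: cvg_toP.
  apply: ereal_nondecreasing_is_cvgn => a b ab.
  apply: lee_sum_nneg_natr => // n _ _.
  by apply: esum_ge0 => s _.
by rewrite nneseries_sum_bigcup.
Qed.

HB.instance Definition _ := isMeasure.Build _ (config N) R (gibbs beta h)
  gibbs0 gibbs_ge0 gibbs_sigma_additive.

Let gibbs_setT : gibbs beta h [set: config N] = 1%E.
Proof.
rewrite /gibbs esum_fset//; last exact: finite_finset.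
rewrite (@fsbigE _ _ _ _ _ (index_enum (config N))) ?index_enum_uniq//; last first.
  by move=> s _ /negP[]; exact: mem_index_enum.
under eq_bigl do rewrite in_setT.
rewrite sumEFin -mulr_suml divff//.
exact/lt0r_neq0/partition_function_gt0.
Qed.

HB.instance Definition _ := @Measure_isProbability.Build _ _ R
  (gibbs beta h : set (config N) -> \bar R) gibbs_setT.

End gibbs_probability.

(* The number of +1 spins among the first k sites, as a real random variable. *)
Definition plus_count (N k : nat) (s : config N) : R :=
  #|[set j : 'I_N | (j < k)%N && s j]%SET|%:R.

Lemma measurable_plus_count (N k : nat) :
  measurable_fun [set: config N] (@plus_count N k).
Proof. by []. Qed.

HB.instance Definition _ (N k : nat) :=
  isMeasurableFun.Build _ _ (config N) _ (@plus_count N k)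
    (@measurable_plus_count N k).

Definition tanh (x : R) : R := (expR x - expR (- x)) / (expR x + expR (- x)).

(* The third clause only selects the sign when h = 0, where the solutions of
   maximal absolute value come in a pair z, - z. *)
Definition is_magnetization (beta h z : R) : Prop :=
  [/\ z = tanh (beta * z + h),
      (forall y, y = tanh (beta * y + h) -> `|y| <= `|z|)
    & h = 0 -> 0 <= z].

Definition magnetization (beta h : R) : R :=
  xget 0 [set z | is_magnetization beta h z].

Definition nat_to_real (j : nat) : R := j%:R.

Lemma measurable_nat_to_real : measurable_fun [set: nat] nat_to_real.
Proof. by []. Qed.

HB.instance Definition _ :=
  isMeasurableFun.Build _ _ nat _ nat_to_real measurable_nat_to_real.

(* [nu] stands for a probability distribution carried by [0, 1]. *)
Definition mixed_binomial_prob (n : nat) (nu : {measure set R -> \bar R}) :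
    set nat -> \bar R :=
  fun U => (\esum_(j in U)
    \int[nu]_(x in `[0%R, 1%R]) (binomial_pmf n x j)%:E)%E.

Section mixed_binomial_measure.
Variables (n : nat) (nu : {measure set R -> \bar R}).

Let mass_ge0 (j : nat) :
  (0 <= \int[nu]_(x in `[0%R, 1%R]) (binomial_pmf n x j)%:E)%E.
Proof.
apply: integral_ge0 => x /=; rewrite in_itv/= => x01.
by rewrite lee_fin binomial_pmf_ge0.
Qed.

Let mixed0 : mixed_binomial_prob n nu set0 = 0%E.
Proof. exact: esum_set0. Qed.

Let mixed_ge0 U : (0 <= mixed_binomial_prob n nu U)%E.
Proof. by apply: esum_ge0 => j _. Qed.

Let mixed_sigma_additive : semi_sigma_additive (mixed_binomial_prob n nu).
Proof.
move=> F mF tF mUF; rewrite /mixed_binomial_prob; apply: cvg_toP.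
  apply: ereal_nondecreasing_is_cvgn => a b ab.
  apply: lee_sum_nneg_natr => // k _ _.
  by apply: esum_ge0 => j _.
by rewrite nneseries_sum_bigcup.
Qed.

HB.instance Definition _ := isMeasure.Build _ _ _ (mixed_binomial_prob n nu)
  mixed0 mixed_ge0 mixed_sigma_additive.

Lemma mixed_binomial_prob1 (j : nat) :
  mixed_binomial_prob n nu [set j] =
  (\int[nu]_(x in `[0%R, 1%R]) (binomial_pmf n x j)%:E)%E.
Proof. by rewrite /mixed_binomial_prob esum_set1. Qed.

Lemma mixed_binomial_prob_setT :
  nu `[0, 1]%classic = 1%E -> mixed_binomial_prob n nu [set: nat] = 1%E.
Proof.
move=> nu1; rewrite /mixed_binomial_prob (esumID `I_n.+1)//.
rewrite [X in (_ + X)%E]esum1 ?adde0; last first.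
  move=> /= k [_ /negP]; rewrite -leqNgt => nk.
  under eq_integral => x _ do rewrite /binomial_pmf bin_small//.
  exact: integral0.
rewrite setTI esum_fset// -fsbig_ord//=.
rewrite -(ge0_integral_sum _ _ (f := fun (k : 'I_n.+1) (x : R) =>
  (binomial_pmf n x k)%:E))//.
- rewrite -[RHS]nu1 -[RHS]mul1e -integral_cst//; apply: eq_integral => x _ /=.
  rewrite sumEFin /binomial_pmf; congr EFin.
  under eq_bigr do rewrite mulrC.
  rewrite -exprDn_comm; last exact: mulrC.
  by rewrite [X in X ^+ n](_ : _ = 1) ?expr1n//; exact: subrK.
- by move=> k; apply/measurable_realfun.measurable_EFinP; exact: measurable_binomial_pmf.
- move=> k x /=; rewrite in_itv/= => x01.
  by rewrite lee_fin binomial_pmf_ge0.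
Qed.

End mixed_binomial_measure.

(* The uniform mixture (delta_a + delta_b) / 2. *)
Definition half_diracs (a b : R) : {measure set R -> \bar R} :=
  mscale (2^-1)%:nng (measure_add \d_a \d_b).

Lemma half_diracs_itv (a b : R) : 0 <= a <= 1 -> 0 <= b <= 1 ->
  half_diracs a b `[0, 1]%classic = 1%E.
Proof.
move=> a01 b01; rewrite /half_diracs /= /mscale/= /measure_add/= /msum/=.
rewrite 2!big_ord_recl big_ord0 /= adde0 !diracE !mem_set/= ?in_itv//=.
by rewrite -EFinD -EFinM; congr EFin; field.
Qed.

(* [binomial_prob] and [mixed_binomial_prob] live on nat; they are transported
   to the Borel sets of the line to be compared there. *)
Definition Bin (n : nat) (p : R) : probability R R :=
  distribution (binomial_prob n p) nat_to_real.

Definition mixed_Bin (n : nat) (nu : {measure set R -> \bar R}) :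
    set R -> \bar R :=
  pushforward (mixed_binomial_prob n nu) nat_to_real.

Section mixed_Bin_measure.
Variables (n : nat) (nu : {measure set R -> \bar R}).

Let mixed_Bin0 : mixed_Bin n nu set0 = 0%E.
Proof. exact: measure0. Qed.

Let mixed_Bin_ge0 A : (0 <= mixed_Bin n nu A)%E.
Proof. exact: measure_ge0. Qed.

Let mixed_Bin_sigma_additive : semi_sigma_additive (mixed_Bin n nu).
Proof.
exact: (@measure_semi_sigma_additive _ _ _
  (pushforward (mixed_binomial_prob n nu) nat_to_real)).
Qed.

HB.instance Definition _ := isMeasure.Build _ _ _ (mixed_Bin n nu)
  mixed_Bin0 mixed_Bin_ge0 mixed_Bin_sigma_additive.

End mixed_Bin_measure.

Definition plus_count_law (N k : nat) (beta h : R) : probability R R :=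
  distribution (gibbs beta h : probability (config N) R) (@plus_count N k).

(* Intended for finite measures, where [fine] loses nothing. *)
Definition dTV (P Q : {measure set R -> \bar R}) : R :=
  sup [set `|fine (P A) - fine (Q A)| | A in @measurable _ R].

(* [normal_pdf] takes the standard deviation; [v1] and [v2] are variances. *)
Definition D (v1 v2 : R) : R :=
  2^-1 * \int[lebesgue_measure]_(t in [set: R])
           `|normal_pdf 0 (Num.sqrt v1) t - normal_pdf 0 (Num.sqrt v2) t|.

End curie_weiss.

(* Main.v *)
Require Import Defs.
From mathcomp Require Import all_boot all_order all_algebra.
From mathcomp Require Import all_classical all_reals all_analysis.
From mathcomp Require Import measurable_realfun.
From mathcomp Require Import ring lra.

(** The quadratic interaction can be linearized: [exp (beta * S ^+ 2 / (2 * N))]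
    is a Gaussian average over [x] of [exp (beta * x * S)]. Given [x] the spins
    are independent, hence the number of positive spins among the first [k] is
    a mixture of binomial laws with success probability [plus_prob beta h x]
    and mixing density proportional to [exp (- N * free_energy beta h x)]
    ([count_pmf_mixture]).

    If [m] is a non-degenerate minimizer of the free energy, the mixing density
    concentrates around [m] and is Gaussian at scale [1 / sqrt N]. At this scale
    the success probability moves linearly in [x], and each binomial law is
    Gaussian at scale [sqrt k]. Integrating one Gaussian against the other gives
    a local limit theorem whose variance is the binomial one, [(1 - m ^+ 2) / 4],
    plus a contribution of the mixture that is proportional to
    [alpha = lim k / N] ([mixture_llt], [mixture_local_limit]). Both limits are
    instances of Laplace's method by dominated convergence. For the binomial law
    this applies because the binomial coefficient is, up to a factor [k + 1],
    the inverse of a Beta integral ([binomial_pmf_lratio], [binomial_llt]).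

    Spreading the atoms of a lattice law over intervals turns local limits into
    pointwise convergence of densities, which Scheffe's lemma upgrades to
    convergence in L1. Therefore the total variation distance between two laws
    with Gaussian local limits around the same centre tends to the one between
    the two Gaussians ([local_limit_l1_dist]).

    It remains to study the minimizers of the free energy. For [h = 0] and
    [beta < 1] it is 0. For [h != 0] it is the magnetization, and the free energy
    is bounded below by a parabola on the whole line
    ([free_energy_ge_high_temperature], [free_energy_ge_line]). For [h = 0] and
    [1 < beta] there are two, [m] and [- m]; each half-line contributes one half
    of the law, near [k * (1 + m) / 2] and [k * (1 - m) / 2]. These halves
    separate and are mirror images of each other, so the distance to the mixed
    binomial law is asymptotically the distance within one of them
    ([symmetrized_l1], [two_phase_limit]). *)

Set Implicit Arguments.
Unset Strict Implicit.
Unset Printing Implicit Defensive.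

Import Order.TTheory GRing.Theory Num.Theory.
Import numFieldNormedType.Exports.

Local Open Scope classical_set_scope.
Local Open Scope ring_scope.

(** * Integration on the real line *)

Definition affine (R : realType) (c d : R) (x : R) : R := c * x + d.

Lemma measurable_affine (R : realType) (c d : R) :
  measurable_fun [set: R] (affine c d).
Proof. by apply: measurable_funD => //; exact: measurable_funM. Qed.

Section affine.
Context {R : realType}.
Local Notation mu := (@lebesgue_measure R).

(** Both sides are measures in [A] that agree on half-open intervals, hence on
    all Borel sets. *)
Lemma lebesgue_measure_affine (c d : R) (A : set R) : c != 0 -> measurable A ->
  mu A = (`|c|%:E * mu (affine c d @^-1` A))%E.
Proof.
move=> c0 mA.
have c1 : 0 <= `|c| by [].
pose nu : {measure set (measurableTypeR R) -> \bar R} :=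
  mscale (NngNum c1) (pushforward mu (affine c d : _ -> measurableTypeR R)).
apply: (@lebesgue_measure_unique R (nu (measurable_affine c d)) _ A mA).
move=> _ [[a b] _ <-] /=; rewrite /mscale/= /pushforward/=.
have [cp|cn|/eqP] := ltrgt0P c; last by rewrite (negbTE c0).
- have -> : affine c d @^-1` `]a, b] = `](a - d) / c, (b - d) / c]%classic.
    apply/seteqP; split => x /=; rewrite !in_itv/= /affine.
      by rewrite ltr_pdivrMr// ler_pdivlMr// (mulrC x); lra.
    by rewrite ltr_pdivrMr// ler_pdivlMr// (mulrC x); lra.
  rewrite !lebesgue_measure_itv/= !lte_fin ltr_pM2r ?invr_gt0// ltrD2r.
  case: ifPn => _; last by rewrite mule0.
  by rewrite -!EFinD -EFinM; congr EFin; field.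
- have -> : affine c d @^-1` `]a, b] = `[(b - d) / c, (a - d) / c[%classic.
    apply/seteqP; split => x /=; rewrite !in_itv/= /affine.
      by rewrite ler_ndivrMr// ltr_ndivlMr// (mulrC x); lra.
    by rewrite ler_ndivrMr// ltr_ndivlMr// (mulrC x); lra.
  rewrite !lebesgue_measure_itv/= !lte_fin ltr_nM2r ?invr_lt0// ltrD2r.
  case: ifPn => _; last by rewrite mule0.
  by rewrite -!EFinD -EFinM; congr EFin; field.
Qed.

Lemma integral_affine (c d : R) (f : R -> \bar R) : c != 0 ->
  measurable_fun [set: R] f -> (forall x, 0 <= f x)%E ->
  (\int[mu]_x f x = `|c|%:E * \int[mu]_x f (c * x + d)%R)%E.
Proof.
move=> c0 mf f0.
have c1 : 0 <= `|c| by [].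
pose nu : {measure set (measurableTypeR R) -> \bar R} :=
  mscale (NngNum c1) (pushforward mu (affine c d : _ -> measurableTypeR R)).
rewrite (eq_measure_integral (nu (measurable_affine c d))); last first.
  by move=> A mA _; exact: lebesgue_measure_affine.
rewrite ge0_integral_mscale//=.
by rewrite ge0_integral_pushforward//; exact: measurable_affine.
Qed.

(** When the integral of [f] is infinite, both sides are [fine +oo = 0]. *)
Lemma ge0_RintegralZl (c : R) (f : R -> R) : 0 < c ->
  measurable_fun [set: R] f -> (forall x, 0 <= f x) ->
  \int[mu]_x (c * f x) = c * \int[mu]_x f x.
Proof.
move=> c0 mf f0; rewrite /Rintegral.
under eq_integral do rewrite EFinM.
rewrite ge0_integralZl//; last 3 first.
- exact/measurable_EFinP.
- by move=> x _; rewrite lee_fin.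
- by rewrite lee_fin ltW.
have := leey (\int[mu]_x (f x)%:E); rewrite le_eqVlt => /predU1P[->|].
  by rewrite gt0_muley ?lte_fin//= mulr0.
rewrite -ge0_fin_numE; last by apply: integral_ge0 => x _; rewrite lee_fin.
by move=> h; rewrite fineM.
Qed.

Lemma Rintegral_sum (I : Type) (r : seq I) (P : pred I)
    (f : I -> R -> R) :
  (forall i, mu.-integrable [set: R] (EFin \o f i)) ->
  \int[mu]_x (\sum_(i <- r | P i) f i x) =
  \sum_(i <- r | P i) \int[mu]_x f i x.
Proof.
move=> i_f; rewrite /Rintegral.
under eq_integral do rewrite -sumEFin.
rewrite integral_sum// sum_fine// => i _.
exact: (integrable_fin_num measurableT (i_f i)).
Qed.

Lemma Rintegral_affine (c d : R) (f : R -> R) : c != 0 ->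
  measurable_fun [set: R] f -> (forall x, 0 <= f x) ->
  \int[mu]_x f x = `|c| * \int[mu]_x f (c * x + d).
Proof.
move=> c0 mf f0; rewrite -ge0_RintegralZl ?normr_gt0//; last first.
  exact: (measurableT_comp mf (measurable_affine c d)).
rewrite /Rintegral (@integral_affine c d)//; last exact/measurable_EFinP.
under [in RHS]eq_integral do rewrite EFinM.
rewrite ge0_integralZl//.
- apply/measurable_EFinP; exact: (measurableT_comp mf (measurable_affine c d)).
- by move=> x _; rewrite lee_fin.
Qed.

(** The bound is asked for large [n] only, because the bounds to which this is
    applied are themselves consequences of limits. *)
Lemma Rintegral_dominated_cvg (f_ : nat -> R -> R) (f g : R -> R) :
  (forall n, measurable_fun [set: R] (f_ n)) ->
  measurable_fun [set: R] f ->
  (forall x, f_ n x @[n --> \oo] --> f x) ->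
  mu.-integrable [set: R] (EFin \o g) ->
  (\forall n \near \oo, forall x, `|f_ n x| <= g x) ->
  \int[mu]_x f_ n x @[n --> \oo] --> \int[mu]_x f x.
Proof.
move=> mf_ mf ff ig [N _ Nfg].
rewrite -(cvg_shiftn N).
have mf' n : measurable_fun [set: R] (fun x => (f_ (n + N)%N x)%:E).
  exact/measurable_EFinP.
have cvf : {ae mu, forall x, [set: R] x ->
    (f_ (n + N)%N x)%:E @[n --> \oo] --> (EFin \o f) x}.
  apply: aeW => x _; apply: cvg_EFin; first exact: nearW.
  by rewrite (cvg_shiftn N (fun n => f_ n x)); exact: ff.
have domf : {ae mu, forall x n, [set: R] x ->
    (`|(f_ (n + N)%N x)%:E| <= (EFin \o g) x)%E}.
  by apply: aeW => x n _; rewrite lee_fin Nfg//= leq_addl.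
have [intf _ ] := @dominated_convergence _ _ _ mu _ measurableT _ _ _ mf'
  ((measurable_EFinP _ _).2 mf) cvf ig domf.
by move=> h; apply: fine_cvg; rewrite fineK//; exact: integrable_fin_num.
Qed.
End affine.

(** * Gaussian integrals and a second-order mean value theorem *)

Section gaussian.
Context {R : realType}.
Local Notation mu := (@lebesgue_measure R).
Implicit Types v s t x y c : R.

Lemma normal_pdf_sqrtE v m t : 0 < v ->
  normal_pdf m (Num.sqrt v) t =
  (Num.sqrt (2 * pi * v))^-1 * expR (- ((t - m) ^+ 2 / (2 * v))).
Proof.
move=> v0; rewrite normal_pdfE ?gt_eqF ?sqrtr_gt0//.
rewrite /normal_peak /normal_fun sqr_sqrtr ?ltW//.
have -> : v * pi *+ 2 = 2 * pi * v by rewrite -mulr_natl; ring.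
by rewrite mulNr -(mulr_natl v).
Qed.

Lemma integral_expR_gauss v m : 0 < v ->
  \int[mu]_x expR (- ((x - m) ^+ 2 / (2 * v))) = Num.sqrt (2 * pi * v).
Proof.
move=> v0; have p0 : 0 < Num.sqrt (2 * pi * v).
  by rewrite sqrtr_gt0 mulr_gt0// mulr_gt0// pi_gt0.
transitivity (Num.sqrt (2 * pi * v) * \int[mu]_x normal_pdf m (Num.sqrt v) x).
  rewrite -RintegralZl//; last exact: integrable_normal_pdf.
  apply: eq_Rintegral => x _; rewrite normal_pdf_sqrtE// mulrA divff ?mul1r//.
  by rewrite gt_eqF.
by rewrite /Rintegral integral_normal_pdf mulr1.
Qed.

Lemma integrable_expR_gauss v m : 0 < v ->
  mu.-integrable [set: R] (fun x => (expR (- ((x - m) ^+ 2 / (2 * v))))%:E).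
Proof.
move=> v0; have p0 : 0 < Num.sqrt (2 * pi * v).
  by rewrite sqrtr_gt0 mulr_gt0// mulr_gt0// pi_gt0.
have := integrableZl measurableT (Num.sqrt (2 * pi * v))
  (integrable_normal_pdf m (Num.sqrt v)).
apply: eq_integrable => //= x _.
by rewrite -EFinM normal_pdf_sqrtE// mulrA divff ?mul1r// gt_eqF.
Qed.

(** A Gaussian average of shifted Gaussians is Gaussian, and the variances add:
    completing the square in [y] leaves a Gaussian integral of variance
    [v * s / (v + a ^+ 2 * s)]. *)
Lemma integral_normal_pdf_mix v s a t : 0 < v -> 0 < s ->
  \int[mu]_y (normal_pdf 0 (Num.sqrt v) (t - a * y) * expR (- (y ^+ 2 / (2 * s))))
  = Num.sqrt (2 * pi * s) * normal_pdf 0 (Num.sqrt (v + a ^+ 2 * s)) t.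
Proof.
move=> v0 s0; set V := v + a ^+ 2 * s.
have V0 : 0 < V by rewrite ltr_wpDr// mulr_ge0 ?sqr_ge0// ltW.
have w0 : 0 < v * s / V by rewrite divr_gt0// mulr_gt0.
have pi0 := @pi_gt0 R.
transitivity ((Num.sqrt (2 * pi * v))^-1 * expR (- (t ^+ 2 / (2 * V))) *
  \int[mu]_y expR (- ((y - a * s * t / V) ^+ 2 / (2 * (v * s / V))))).
  rewrite -RintegralZl//; last exact: integrable_expR_gauss.
  apply: eq_Rintegral => y _; rewrite normal_pdf_sqrtE// -!mulrA; congr (_ * _).
  rewrite -!expRD; congr expR; rewrite /V; field.
  by rewrite gt_eqF//= gt_eqF// gt_eqF.
rewrite integral_expR_gauss// normal_pdf_sqrtE// subr0.
rewrite mulrAC [RHS]mulrA; congr (_ * _).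
have h2 : 0 <= 2 * pi * v by rewrite !mulr_ge0 ?ltW.
have h3 : 0 <= 2 * pi * V by rewrite !mulr_ge0 ?ltW.
have h4 : 0 <= 2 * pi * s by rewrite !mulr_ge0 ?ltW.
rewrite -sqrtrV// -sqrtrV// -!sqrtrM ?invr_ge0//; congr Num.sqrt.
clearbody V; move: (pi : R) pi0 {h2 h3 h4} => p p0.
by field; rewrite !gt_eqF.
Qed.

End gaussian.

Section quadratic_mvt.
Context {R : realType}.

Lemma MVT_is_derive (f f' : R -> R) (u v : R) : u < v ->
  (forall x : R, is_derive x 1 f (f' x)) ->
  exists2 x, u < x < v & f v - f u = f' x * (v - u).
Proof.
move=> uv df; have cf : {within `[u, v], continuous f}.
  by apply: derivable_within_continuous => x _;
    exact: (@ex_derive _ _ _ _ _ _ _ (df x)).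
have [x] := MVT uv (fun x _ => df x) cf.
by rewrite in_itv/= => ? ?; exists x.
Qed.

(** Rolle's theorem for [F s * (x - q) ^+ 2 - (s - q) ^+ 2 * F x], which vanishes
    at [q] and at [x]. With the derivative in factored form, a bound on [r]
    between [q] and [x] is a quadratic bound on [F x], and continuity of [r] is
    a second-order expansion of [F] at [q]. *)
Lemma quadratic_mvt (F r : R -> R) (q x : R) : q != x -> F q = 0 ->
  (forall s, Num.min q x <= s <= Num.max q x ->
     is_derive s 1 F ((s - q) * r s)) ->
  exists2 xi, Num.min q x < xi < Num.max q x & F x = r xi * (x - q) ^+ 2 / 2.
Proof.
move=> qx Fq dF.
set a := Num.min q x; set b := Num.max q x.
have [ab abE] : a < b /\ ((a = q /\ b = x) \/ (a = x /\ b = q)).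
  rewrite /a /b; move: qx; rewrite neq_lt => /orP[qx|qx].
    by rewrite min_l ?max_r ?ltW//; split; [|left].
  by rewrite min_r ?max_l ?ltW//; split; [|right].
pose H s := F s * (x - q) ^+ 2 - (s - q) ^+ 2 * F x.
have dH s : a <= s <= b ->
    is_derive s 1 H ((s - q) * (r s * (x - q) ^+ 2 - 2 * F x)).
  move=> /dF dFs.
  apply: is_derive_eq.
  rewrite /= !scaler0 /GRing.scale/=; ring.
have Hq : H q = 0 by rewrite /H Fq; ring.
have Hx : H x = 0 by rewrite /H; ring.
have Hab : H a = H b by case: abE => -[-> ->]; rewrite Hq Hx.
have drH s : a <= s <= b -> derivable H s 1.
  by move=> sab; apply: ex_derive; exact: dH.
have cH : {within `[a, b], continuous H}.
  by apply: derivable_within_continuous => s; rewrite in_itv/=; exact: drH.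
have doH s : s \in `]a, b[ -> derivable H s 1.
  by rewrite in_itv/= => /andP[? ?]; apply: drH; rewrite !ltW.
have [xi] := Rolle ab doH cH Hab.
rewrite in_itv/= => xiab dH0; exists xi => //.
have := dH xi; case/andP: (xiab) => axi xib; rewrite !ltW// => /(_ erefl) dHxi.
have : (xi - q) * (r xi * (x - q) ^+ 2 - 2 * F x) = 0.
  by rewrite -[LHS](@derive_val _ _ _ _ _ _ _ dHxi) (@derive_val _ _ _ _ _ _ _ dH0).
move/eqP; rewrite mulf_eq0 subr_eq0 => /orP[/eqP xiq|/eqP]; last by lra.
by move: axi xib; rewrite xiq; case: abE => -[-> ->]; rewrite ?ltxx.
Qed.

End quadratic_mvt.

(** * Relative entropy of Bernoulli laws *)

Section sequences.
Context {R : realType}.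

Lemma cvg_sqrtn (k : nat -> nat) : k @ \oo --> \oo ->
  Num.sqrt (k n)%:R @[n --> \oo] --> (+oo : set_system R).
Proof.
move=> koo; apply/cvgryPge => A.
have /cvgnyPge/(_ (Num.truncn (A ^+ 2)).+1) := koo; apply: filterS => n An.
have [A0|A0] := leP A 0; first exact: le_trans (sqrtr_ge0 _).
rewrite -(ler_pXn2r (n := 2)) ?nnegrE ?sqrtr_ge0 ?(ltW A0)// sqr_sqrtr//.
by rewrite ltW// (lt_le_trans (truncnS_gt _))// ler_nat.
Qed.

Lemma cvg_of_scaled (a u : nat -> R) (p t : R) :
  a n @[n --> \oo] --> +oo -> a n * (u n - p) @[n --> \oo] --> t ->
  u n @[n --> \oo] --> p.
Proof.
move=> aoo aut.
have a_gt0 : \forall n \near \oo, 0 < a n.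
  by have /cvgryPgt := aoo; apply.
have ai : (a n)^-1 @[n --> \oo] --> (0 : R) by apply/gtr0_cvgV0.
have h : p + (a n)^-1 * (a n * (u n - p)) @[n --> \oo] --> p + 0 * t.
  by apply: cvgD; [exact: cvg_cst|exact: cvgM].
rewrite mul0r addr0 in h.
apply: cvg_trans h; apply: near_eq_cvg; near=> n.
rewrite mulKf; first by ring.
by apply: lt0r_neq0; near: n.
Unshelve. all: by end_near. Qed.

End sequences.

Section likelihood.
Context {R : realType}.
Implicit Types p q x s t : R.

(** The relative entropy of the Bernoulli law of parameter [q] with respect to
    that of parameter [x]. *)
Definition kl q x : R :=
  q * (ln q - ln x) + (1 - q) * (ln (1 - q) - ln (1 - x)).

Lemma is_derive_kl q x : 0 < x < 1 ->
  is_derive x 1 (kl q) ((x - q) * (x * (1 - x))^-1).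
Proof.
move=> /andP[x0 x1].
have x1' : 0 < 1 - x by rewrite subr_gt0.
have d1 : is_derive x 1 (fun x : R => ln x) x^-1 by exact: is_derive1_ln.
have d2 : is_derive x 1 (fun x : R => ln (1 - x)) (- (1 - x)^-1).
  have d3 := is_derive1_ln x1'.
  have d4 : is_derive x 1 (fun x : R => 1 - x) (-1).
    by apply: is_derive_eq; ring.
  by have := @is_derive1_comp R (@ln R) (fun x => 1 - x) x _ _ d3 d4;
    rewrite mulrN1.
apply: is_derive_eq.
rewrite /GRing.scale/=; field.
by rewrite (gt_eqF x0) (gt_eqF x1').
Qed.

Lemma kl_mvt q x : 0 < q < 1 -> 0 < x < 1 ->
  exists2 xi, Num.min q x <= xi <= Num.max q x &
    kl q x = (x - q) ^+ 2 / (2 * (xi * (1 - xi))).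
Proof.
move=> /andP[q0 q1] /andP[x0 x1].
have klq : kl q q = 0 by rewrite /kl; ring.
have [<-|qx] := eqVneq q x.
  by exists q; rewrite ?ge_min ?le_max ?lexx// klq subrr expr0n/= mul0r.
have [|xi /andP[xi0 xi1] ->] := @quadratic_mvt _ (kl q) (fun s => (s * (1 -
  s))^-1) _ _ qx klq.
  move=> s /andP[s0 s1]; apply: is_derive_kl.
  rewrite (lt_le_trans _ s0) ?lt_min ?q0//= (le_lt_trans s1)//.
  by rewrite gt_max q1.
exists xi; first by rewrite !ltW.
by rewrite (invfM 2); ring.
Qed.

(** Pinsker's inequality: [xi * (1 - xi) <= 4^-1] in [kl_mvt]. *)
Lemma kl_ge q x : 0 < q < 1 -> 0 < x < 1 -> 2 * (x - q) ^+ 2 <= kl q x.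
Proof.
move=> q01 x01; have [xi /andP[xi0 xi1] ->] := kl_mvt q01 x01.
move: q01 x01 => /andP[q0 q1] /andP[x0 x1].
have xi0' : 0 < xi by rewrite (lt_le_trans _ xi0) ?lt_min ?q0.
have xi1' : 0 < 1 - xi by rewrite subr_gt0 (le_lt_trans xi1)// gt_max q1.
rewrite mulrC ler_wpM2l ?sqr_ge0//.
rewrite -[leLHS]invrK lef_pV2 ?posrE ?mulr_gt0 ?invr_gt0//.
have := sqr_ge0 (2 * xi - 1); lra.
Qed.

(** At distance [1 / a n] from [p] the relative entropy is quadratic: the
    intermediate point of [kl_mvt] is squeezed to [p] with [q n] and [x n]. *)
Lemma kl_scaled_cvg (a q x : nat -> R) p t s : 0 < p < 1 ->
  a n @[n --> \oo] --> +oo ->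
  a n * (q n - p) @[n --> \oo] --> t ->
  a n * (x n - p) @[n --> \oo] --> s ->
  a n ^+ 2 * kl (q n) (x n) @[n --> \oo] --> (t - s) ^+ 2 / (2 * (p * (1 - p))).
Proof.
move=> p01 aoo aq ax; have /andP[p0 p1] := p01.
have qp := cvg_of_scaled aoo aq; have xp := cvg_of_scaled aoo ax.
(* [xi n] is arbitrary while [q n] or [x n] is outside of ]0, 1[. *)
have /choice[xi xiP] n : exists y, 0 < q n < 1 -> 0 < x n < 1 ->
    `|y - p| <= `|q n - p| + `|x n - p| /\
    kl (q n) (x n) = (x n - q n) ^+ 2 / (2 * (y * (1 - y))).
  have [q01|] := boolP (0 < q n < 1); last by exists 0.
  have [x01|] := boolP (0 < x n < 1); last by exists 0.
  have [y /andP[y0 y1] yE] := kl_mvt q01 x01; exists y => _ _; split => //.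
  move: y0 y1; rewrite ge_min le_max ler_norml => /orP y0 /orP y1.
  have := ler_norm (q n - p); have := ler_norm (x n - p).
  have := lerNnormlW (lexx `|q n - p|); have := lerNnormlW (lexx `|x n - p|).
  by move=> ? ? ? ?; apply/andP; split; case: y0 => ?; case: y1 => ?; lra.
have near01 (u : nat -> R) : u n @[n --> \oo] --> p -> \forall n \near \oo, 0 < u
  n < 1.
  move=> up; near=> n; apply/andP; split; near: n.
    exact: (cvgr_gt _ up).
  exact: (cvgr_lt _ up).
have q01 := near01 _ qp; have x01 := near01 _ xp.
have norm0 (u : nat -> R) : u n @[n --> \oo] --> p -> `|u n - p| @[n --> \oo] --> 0.
  move=> up; rewrite -[X in _ --> X](normr0 R) -(subrr p).
  by apply: cvg_norm; apply: cvgB => //; exact: cvg_cst.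
have xip : xi n @[n --> \oo] --> p.
  have e0 : `|q n - p| + `|x n - p| @[n --> \oo] --> (0 : R).
    by rewrite -[X in _ --> X](addr0 0); apply: cvgD; exact: norm0.
  apply: (@squeeze_cvgr _ _ _ _ (fun n => p - (`|q n - p| + `|x n - p|))
    (fun n => p + (`|q n - p| + `|x n - p|))).
  - near=> n.
    have [] := xiP n; [by near: n|by near: n|].
    by rewrite ler_norml => /andP[? ?] _; apply/andP; split; lra.
  - by rewrite -[X in _ --> X]subr0; apply: cvgB => //; exact: cvg_cst.
  - by rewrite -[X in _ --> X]addr0; apply: cvgD => //; exact: cvg_cst.
have lim : (a n * (q n - p) - a n * (x n - p)) ^+ 2 / (2 * (xi n * (1 - xi n)))
    @[n --> \oo] --> (t - s) ^+ 2 / (2 * (p * (1 - p))).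
  apply: cvgM.
    by rewrite !expr2; apply: cvgM; apply: cvgB.
  apply: cvgV; first by rewrite gt_eqF// !mulr_gt0// subr_gt0.
  apply: cvgM; first exact: cvg_cst.
  by apply: cvgM => //; apply: cvgB => //; exact: cvg_cst.
apply: cvg_trans lim; apply: near_eq_cvg; near=> n.
have [] := xiP n; [by near: n|by near: n|].
by move=> _ ->; ring.
Unshelve. all: by end_near. Qed.

End likelihood.

(** * Local limit theorem for binomial laws *)

Section binomial_pmf.
Context {R : realType}.

Lemma binomial_pmfE (n : nat) (p : R) (j : nat) :
  binomial_pmf n p j = p ^+ j * (1 - p) ^+ (n - j) *+ 'C(n, j).
Proof. by []. Qed.

Lemma sum_binomial_pmf (n : nat) (p : R) : \sum_(j < n.+1) binomial_pmf n p j = 1.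
Proof.
rewrite /binomial_pmf; under eq_bigr do rewrite mulrC.
by rewrite -exprDn_comm; [rewrite subrK expr1n|exact: mulrC].
Qed.

Lemma binomial_pmf_onem (k j : nat) (x : R) : (j <= k)%N ->
  binomial_pmf k (1 - x) j = binomial_pmf k x (k - j).
Proof.
move=> jk; rewrite !binomial_pmfE bin_sub// subKn// [in RHS]mulrC.
by have -> : 1 - (1 - x) = x by ring.
Qed.

End binomial_pmf.

Section binomial_llt.
Context {R : realType}.
Local Notation mu := (@lebesgue_measure R).
Implicit Types p q x s t : R.

Lemma XMonemX_kl (k j : nat) x : (0 < j < k)%N -> 0 < x < 1 ->
  XMonemX j (k - j) x =
  expR (- (k%:R * kl (j%:R / k%:R) x)) * XMonemX j (k - j) (j%:R / k%:R).
Proof.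
move=> /andP[j0 jk] /andP[x0 x1].
have k0 : (0 : R) < k%:R by rewrite ltr0n (ltn_trans j0).
have q0 : (0 : R) < j%:R / k%:R by rewrite divr_gt0// ltr0n.
have q1 : (0 : R) < 1 - j%:R / k%:R.
  by rewrite subr_gt0 ltr_pdivrMr// mul1r ltr_nat.
have x1' : 0 < 1 - x by rewrite subr_gt0.
have E y : 0 < y -> 0 < 1 - y ->
    XMonemX j (k - j) y = expR (j%:R * ln y + (k - j)%:R * ln (1 - y)).
  by move=> y0 y1; rewrite expRD !expRM_natl !lnK.
rewrite !E// -expRD; congr expR; rewrite /kl natrB ?(ltnW jk)//.
by field; rewrite gt_eqF.
Qed.

(** The likelihood of [x] after [j] successes in [k] trials, divided by its
    maximum, which is at [j / k]. It is cut off outside of the unit interval so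
    that its integral over the line is a Beta integral. *)
Definition lratio (k j : nat) (x : R) : R :=
  ((@XMonemX R j (k - j)) \_ `[0, 1]) x / XMonemX j (k - j) (j%:R / k%:R).

Lemma measurable_lratio k j : measurable_fun [set: R] (lratio k j).
Proof.
apply: measurable_funM => //; apply/measurable_restrict => //.
by rewrite setTI; exact: measurable_XMonemX.
Qed.

Lemma XMonemX_frac_gt0 (k j : nat) : (0 < j < k)%N ->
  0 < XMonemX j (k - j) (j%:R / k%:R : R).
Proof.
move=> /andP[j0 jk]; have k0 : (0 : R) < k%:R by rewrite ltr0n (ltn_trans j0).
have q0 : (0 : R) < j%:R / k%:R by rewrite divr_gt0// ltr0n.
have q1 : (0 : R) < 1 - j%:R / k%:R.
  by rewrite subr_gt0 ltr_pdivrMr// mul1r ltr_nat.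
by rewrite mulr_gt0// exprn_gt0.
Qed.

Lemma lratio_ge0 k j x : (0 < j < k)%N -> 0 <= lratio k j x.
Proof.
move=> jk; rewrite divr_ge0 ?(ltW (XMonemX_frac_gt0 _))//.
by rewrite patchE; case: ifPn => //; rewrite inE => /XMonemX_ge0.
Qed.

Lemma lratio_kl k j x : (0 < j < k)%N -> 0 < x < 1 ->
  lratio k j x = expR (- (k%:R * kl (j%:R / k%:R) x)).
Proof.
move=> jk x01; rewrite /lratio patchE mem_set/=; last first.
  by rewrite in_itv/=; case/andP: x01 => ? ?; rewrite !ltW.
by rewrite XMonemX_kl// mulfK// gt_eqF// XMonemX_frac_gt0.
Qed.

(** The Gaussian bound that dominates all integrals of this part. *)
Lemma lratio_le k j x : (0 < j < k)%N ->
  lratio k j x <= expR (- (k%:R * (2 * (x - j%:R / k%:R) ^+ 2))).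
Proof.
move=> jk; have [x01|] := boolP (0 < x < 1).
  rewrite lratio_kl// ler_expR lerN2 ler_wpM2l// kl_ge//.
  case/andP: jk => j0 jk; have k0 : (0 : R) < k%:R by rewrite ltr0n (ltn_trans j0).
  by rewrite divr_gt0//= ?ltr0n// ltr_pdivrMr// mul1r ltr_nat.
rewrite /lratio patchE; case: ifPn; last by rewrite mul0r expR_ge0.
rewrite inE/= in_itv/= => /andP[x0 x1].
rewrite negb_and -!leNgt => /orP[x0'|x1'].
  have -> : x = 0 by apply/eqP; rewrite eq_le x0 x0'.
  by case/andP: jk => j0 _; rewrite /XMonemX expr0n eqn0Ngt j0/= !mul0r expR_ge0.
have -> : x = 1 by apply/eqP; rewrite eq_le x1 x1'.
case/andP: jk => _ jk.
have -> : XMonemX j (k - j) (1 : R) = 0.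
  transitivity ((1 : R) ^+ j * (1 - 1) ^+ (k - j)); first by [].
  by rewrite subrr expr0n subn_eq0 leqNgt jk/= mulr0.
by rewrite mul0r expR_ge0.
Qed.

(** The inverse of [(k + 1) * 'C(k, j)] is a Beta integral, so the binomial mass
    is the likelihood ratio divided by [k + 1] times its own integral. The local
    limit theorem thus follows from the asymptotics of that integral, without
    Stirling's formula. *)
Lemma binomial_pmf_lratio k j x : (0 < j < k)%N -> 0 <= x <= 1 ->
  binomial_pmf k x j = lratio k j x / (k.+1%:R * \int[mu]_y lratio k j y).
Proof.
move=> jk x01; have Lq := XMonemX_frac_gt0 jk.
have jk' : (j <= k)%N by case/andP: jk => _ /ltnW.
have -> : \int[mu]_y lratio k j y =
    beta_fun j.+1 (k - j).+1 / XMonemX j (k - j) (j%:R / k%:R).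
  by rewrite /lratio RintegralZr//=;
    exact: (integrable_XMonemX_restrict j.+1 (k - j).+1).
rewrite beta_fun_fact subnKC// /lratio patchE mem_set//=.
rewrite /binomial_pmf -mulr_natr.
have -> : 'C(k, j)%:R = k`!%:R / (j`! * (k - j)`!)%:R :> R.
  by rewrite -(bin_fact jk') natrM mulfK// pnatr_eq0 muln_eq0 -!lt0n !fact_gt0.
rewrite factS (natrM _ k.+1) -/(XMonemX j (k - j) x).
field.
by rewrite (gt_eqF Lq) !pnatr_eq0 -!lt0n !fact_gt0 nat1r pnatr_eq0.
Qed.

Variables (k j : nat -> nat) (p t : R).
Hypothesis koo : k @ \oo --> \oo.
Hypothesis p01 : 0 < p < 1.
Let a n : R := Num.sqrt (k n)%:R.
Let q n : R := (j n)%:R / (k n)%:R.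
Hypothesis jt : a n * (q n - p) @[n --> \oo] --> t.

Let aoo : a n @[n --> \oo] --> +oo. Proof. exact: cvg_sqrtn. Qed.

Let a_gt0 : \forall n \near \oo, 0 < a n.
Proof. by have /cvgryPgt := aoo; apply. Qed.

Let v0 : 0 < p * (1 - p).
Proof. by case/andP: p01 => ? ?; rewrite mulr_gt0// subr_gt0. Qed.

Let near_jk : \forall n \near \oo, (0 < j n < k n)%N.
Proof.
have qp := cvg_of_scaled aoo jt; case/andP: p01 => p0 p1.
near=> n.
have an : 0 < a n by near: n.
have kn : (0 : R) < (k n)%:R by rewrite -sqrtr_gt0.
have q0 : 0 < q n by near: n; exact: (cvgr_gt _ qp).
have q1 : q n < 1 by near: n; exact: (cvgr_lt _ qp).
move: q0 q1; rewrite /q ltr_pdivrMr// mul1r ltr_nat pmulr_lgt0 ?invr_gt0// ltr0n.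
by move=> -> ->.
Unshelve. all: by end_near. Qed.

Lemma lratio_cvg (x : nat -> R) s :
  a n * (x n - p) @[n --> \oo] --> s ->
  lratio (k n) (j n) (x n) @[n --> \oo] -->
  expR (- ((s - t) ^+ 2 / (2 * (p * (1 - p))))).
Proof.
move=> ax; have xp := cvg_of_scaled aoo ax; case/andP: (p01) => p0 p1.
have h : expR (- (a n ^+ 2 * kl (q n) (x n))) @[n --> \oo] -->
    expR (- ((t - s) ^+ 2 / (2 * (p * (1 - p))))).
  apply: (@cvg_comp _ _ _ _ expR _ (nbhs (- ((t - s) ^+ 2 / (2 * (p * (1 - p)))))));
    last exact: continuous_expR.
  by apply: cvgN; exact: kl_scaled_cvg.
rewrite -(sqrrN (s - t)) opprB; apply: cvg_trans h; apply: near_eq_cvg; near=> n.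
rewrite lratio_kl//; first by rewrite sqr_sqrtr.
- by near: n.
- apply/andP; split; near: n; [exact: (cvgr_gt _ xp)|exact: (cvgr_lt _ xp)].
Unshelve. all: by end_near. Qed.

(** The integral of the likelihood ratio in the variable [y = a n * (x - p)]. *)
Let I n : R := \int[mu]_y lratio (k n) (j n) ((a n)^-1 * y + p).

(** Laplace's method. The bound [lratio_le] is a Gaussian in [y] centred at
    [a n * (q n - p)], which is eventually within 1 of [t]; the factor [expR 2]
    pays for recentring it at [t]. *)
Let I_cvg : I n @[n --> \oo] --> Num.sqrt (2 * pi * (p * (1 - p))).
Proof.
rewrite -(integral_expR_gauss t v0).
apply: (@Rintegral_dominated_cvg _ _ _
    (fun y => expR 2 * expR (- ((y - t) ^+ 2 / (2 * 2^-1))))).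
- move=> n; apply: measurableT_comp; first exact: measurable_lratio.
  by apply: measurable_funD => //; exact: measurable_funM.
- apply: measurableT_comp => //; apply: measurableT_comp => //.
  apply: measurable_funM => //; apply: measurable_funX.
  exact: measurable_funB.
- move=> y; apply: lratio_cvg.
  have ycst : y @[_ --> \oo] --> y by exact: cvg_cst.
  apply: cvg_trans ycst; apply: near_eq_cvg; near=> n.
  by rewrite addrK mulVKf//; apply: lt0r_neq0; near: n.
- have := @integrable_expR_gauss R 2^-1 t.
  by rewrite invr_gt0 ltr0n => /(_ erefl) /(integrableZl measurableT (expR 2)).
- have near_t : \forall n \near \oo, `|t - a n * (q n - p)| <= 1.
    by move/cvgrPdist_le : jt; apply.
  near=> n; move=> y.
  have jk : (0 < j n < k n)%N by near: n.
  have an : 0 < a n by near: n.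
  rewrite ger0_norm ?lratio_ge0//.
  apply: (le_trans (lratio_le _ jk)); rewrite -expRD ler_expR.
  have -> : (k n)%:R * (2 * ((a n)^-1 * y + p - (j n)%:R / (k n)%:R) ^+ 2) =
      a n ^+ 2 * (2 * ((a n)^-1 * y + p - q n) ^+ 2) by rewrite sqr_sqrtr.
  have -> : a n ^+ 2 * (2 * ((a n)^-1 * y + p - q n) ^+ 2) =
     2 * (y - a n * (q n - p)) ^+ 2.
    by move: (q n) (a n) an => qn an an0; field; rewrite gt_eqF.
  have : `|t - a n * (q n - p)| <= 1.
    by near: n.
  rewrite ler_norml mulfV ?divr1// => /andP[u1 u2].
  have -> : y - t = (y - a n * (q n - p)) - (t - a n * (q n - p)) by ring.
  move: (y - _) (t - _) u1 u2 => A B u1 u2.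
  have B1 : B ^+ 2 <= 1 by rewrite expr2; nra.
  have := sqr_ge0 (A + B); rewrite !expr2 in B1 *; lra.
Unshelve. all: by end_near. Qed.

Let I_gt0 : \forall n \near \oo, Num.sqrt (2 * pi * (p * (1 - p))) / 2 < I n.
Proof.
apply: (cvgr_gt _ I_cvg).
have : 0 < Num.sqrt (2 * pi * (p * (1 - p))).
  by rewrite sqrtr_gt0 mulr_gt0// mulr_gt0// pi_gt0.
lra.
Qed.

Let pmfE n x : 0 < a n -> (0 < j n < k n)%N -> 0 <= x <= 1 ->
  a n * binomial_pmf (k n) x (j n) =
  (k n)%:R / (k n).+1%:R * (lratio (k n) (j n) x / I n).
Proof.
move=> an jk x01; rewrite binomial_pmf_lratio//.
rewrite (@Rintegral_affine _ (a n)^-1 p)//; last first.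
- by move=> y; exact: lratio_ge0.
- exact: measurable_lratio.
- by rewrite invr_neq0// gt_eqF.
rewrite -/(I n) ger0_norm ?invr_ge0 ?ltW//.
rewrite !invfM invrK.
have -> : (k n)%:R = a n ^+ 2 by rewrite sqr_sqrtr.
by move: (_.+1%:R^-1) => c; ring.
Qed.

(** The success probability [x n] may drift at the scale of the fluctuations,
    which shifts the limiting Gaussian. *)
Lemma binomial_llt (x : nat -> R) s :
  (forall n, 0 <= x n <= 1) ->
  a n * (x n - p) @[n --> \oo] --> s ->
  a n * binomial_pmf (k n) (x n) (j n) @[n --> \oo] -->
  normal_pdf 0 (Num.sqrt (p * (1 - p))) (t - s).
Proof.
move=> x01 xs; rewrite normal_pdf_sqrtE// subr0.
have kk : (k n)%:R / (k n).+1%:R @[n --> \oo] --> (1 : R).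
  have h : (1 : R) - (k n).+1%:R^-1 @[n --> \oo] --> (1 - 0 : R).
    apply: cvgB; first exact: cvg_cst.
    exact: (cvg_comp _ _ koo (@cvg_harmonic R)).
  rewrite subr0 in h; apply: cvg_trans h; apply: near_eq_cvg; near=> n.
  by rewrite -natr1; field; rewrite natr1 pnatr_eq0.
have sq0 : Num.sqrt (2 * pi * (p * (1 - p))) != 0.
  by rewrite gt_eqF// sqrtr_gt0 mulr_gt0// mulr_gt0// pi_gt0.
have h : (k n)%:R / (k n).+1%:R * (lratio (k n) (j n) (x n) / I n)
    @[n --> \oo] --> 1 * (expR (- ((s - t) ^+ 2 / (2 * (p * (1 - p))))) /
      Num.sqrt (2 * pi * (p * (1 - p)))).
  by apply: cvgM => //; apply: cvgM; [exact: lratio_cvg|exact: cvgV].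
rewrite mul1r mulrC -(sqrrN (s - t)) opprB in h.
apply: cvg_trans h; apply: near_eq_cvg; near=> n.
by rewrite pmfE//; near: n.
Unshelve. all: by end_near. Qed.

(** Uniformity in [x] is what allows dominated convergence when the success
    probability is itself random. It holds because [lratio] is at most 1. *)
Lemma binomial_pmf_bounded : exists B : R, \forall n \near \oo,
  forall x, 0 <= x <= 1 -> a n * binomial_pmf (k n) x (j n) <= B.
Proof.
have c0 : 0 < Num.sqrt (2 * pi * (p * (1 - p))) / 2.
  by rewrite divr_gt0// sqrtr_gt0 mulr_gt0// mulr_gt0// pi_gt0.
exists (Num.sqrt (2 * pi * (p * (1 - p))) / 2)^-1.
near=> n; move=> x x01.
have jk : (0 < j n < k n)%N by near: n.
have In : Num.sqrt (2 * pi * (p * (1 - p))) / 2 < I n by near: n.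
have I0 := lt_trans c0 In.
rewrite pmfE//; last by near: n.
have l1 : lratio (k n) (j n) x <= 1.
  apply: le_trans (lratio_le _ jk) _; rewrite -[leRHS]expR0 ler_expR oppr_le0.
  by do 2 rewrite mulr_ge0//; rewrite sqr_ge0.
have k1 : (k n)%:R / (k n).+1%:R <= 1 :> R.
  by rewrite ler_pdivrMr// mul1r ler_nat.
apply: (@le_trans _ _ (1 * (1 / I n))).
  apply: ler_pM => //; first by rewrite divr_ge0 ?lratio_ge0// ltW.
  by rewrite ler_wpM2r// invr_ge0 ltW.
by rewrite !mul1r lef_pV2 ?posrE// ltW.
Unshelve. all: by end_near. Qed.

End binomial_llt.

(** * Local limit theorem for mixtures of binomial laws *)

Section scaled_increments.
Context {R : realType}.

Lemma diff_quotient_cvg (f : R -> R) (m d : R) (x : nat -> R) :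
  is_derive m 1 f d -> x n @[n --> \oo] --> m ->
  (\forall n \near \oo, x n != m) ->
  (f (x n) - f m) / (x n - m) @[n --> \oo] --> d.
Proof.
move=> fd xm xNm.
have fdm : h^-1 *: ((f \o shift m) (h *: (1 : R)) - f m) @[h --> 0^'] --> d.
  by rewrite -(@derive_val _ _ _ _ _ _ _ fd); exact: (@ex_derive _ _ _ _ _ _ _ fd).
have um : x n - m @[n --> \oo] --> 0^'.
  move=> A; rewrite /nbhs/= /dnbhs/= /within/= => A0.
  have x0 : x n - m @[n --> \oo] --> 0.
    by rewrite -(subrr m); apply: cvgB => //; exact: cvg_cst.
  have {A0}A0 := x0 _ A0.
  near=> n; have : x n - m != 0 -> A (x n - m) by near: n.
  by apply; rewrite subr_eq0; near: n.
have := cvg_comp _ _ um fdm.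
apply: cvg_trans; apply: near_eq_cvg; apply: nearW => n /=.
by rewrite /GRing.scale/= mulr1 subrK mulrC.
Unshelve. all: by end_near. Qed.

Lemma scaled_cvg0 (a : nat -> R) (m y : R) : a n @[n --> \oo] --> +oo ->
  (a n)^-1 * y + m @[n --> \oo] --> m.
Proof.
move=> aoo.
have a_gt0 : \forall n \near \oo, 0 < a n.
  by have /cvgryPgt := aoo; apply.
rewrite -[X in _ --> X]add0r -(mul0r y).
apply: cvgD; last exact: cvg_cst.
by apply: cvgM; [exact/gtr0_cvgV0|exact: cvg_cst].
Qed.

Lemma scaled_increment_cvg (f : R -> R) (m d y : R) (a : nat -> R) :
  is_derive m 1 f d -> a n @[n --> \oo] --> +oo ->
  a n * (f ((a n)^-1 * y + m) - f m) @[n --> \oo] --> d * y.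
Proof.
move=> fd aoo; have [->|y0] := eqVneq y 0.
  rewrite mulr0; apply: (cvg_trans _ (@cvg_cst R^o 0 nat \oo _)).
  by apply: near_eq_cvg; apply: nearW => n; rewrite mulr0 add0r subrr mulr0.
have a_gt0 : \forall n \near \oo, 0 < a n.
  by have /cvgryPgt := aoo; apply.
have h : (f ((a n)^-1 * y + m) - f m) / ((a n)^-1 * y + m - m) * y
    @[n --> \oo] --> d * y.
  apply: cvgM; last exact: cvg_cst.
  apply: diff_quotient_cvg => //; first exact: scaled_cvg0.
  near=> n; rewrite -subr_eq0 addrK mulf_neq0// invr_neq0//.
  by apply: lt0r_neq0; near: n.
apply: cvg_trans h; apply: near_eq_cvg; near=> n.
have an : 0 < a n by near: n.
rewrite addrK; move: (f _ - _) => z.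
by field; rewrite y0 gt_eqF.
Unshelve. all: by end_near. Qed.

(** [quadratic_mvt] with [r s = (f' s - f' m) / (s - m)]: the intermediate point
    tends to [m], where [r] tends to the derivative [c] of [f']. *)
Lemma scaled_minimum_cvg (f f' : R -> R) (m c y : R) (a : nat -> R) :
  (forall x : R, is_derive x 1 f (f' x)) -> f' m = 0 -> is_derive m 1 f' c ->
  a n @[n --> \oo] --> +oo ->
  a n ^+ 2 * (f ((a n)^-1 * y + m) - f m) @[n --> \oo] --> c * y ^+ 2 / 2.
Proof.
move=> ff' f'm f'c aoo; have [->|y0] := eqVneq y 0.
  rewrite expr0n/= mulr0 mul0r; apply: (cvg_trans _ (@cvg_cst R^o 0 nat \oo _)).
  by apply: near_eq_cvg; apply: nearW => n; rewrite mulr0 add0r subrr mulr0.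
have a_gt0 : \forall n \near \oo, 0 < a n.
  by have /cvgryPgt := aoo; apply.
pose x n := (a n)^-1 * y + m.
have xm : x n @[n --> \oo] --> m by exact: scaled_cvg0.
pose r s := (f' s - f' m) / (s - m).
have /choice[xi xiP] n : exists z, x n != m ->
    [/\ z != m, `|z - m| <= `|x n - m| & f (x n) - f m = r z * (x n - m) ^+ 2 / 2].
  have [->|xNm] := eqVneq (x n) m; first by exists 0.
  have [||s _|z /andP[z0 z1] zE] := @quadratic_mvt R (fun s => f s - f m) r m (x n).
  - by rewrite eq_sym.
  - by rewrite subrr.
  - apply: is_derive_eq; rewrite /r f'm !subr0.
    have [->|sm] := eqVneq s m; first by rewrite subrr mul0r f'm.
    by rewrite mulrC divfK// subr_eq0.
  exists z => _; split => //.
    by move: z0 z1; rewrite gt_min lt_max => /orP[?|?] /orP[?|?]; rewrite neq_lt;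
      lra.
  move: z0 z1; rewrite gt_min lt_max ler_norml => /orP z0 /orP z1.
  have := ler_norm (x n - m); have := lerNnormlW (lexx `|x n - m|).
  by move=> ? ?; apply/andP; split; case: z0 => ?; case: z1 => ?; lra.
have xNm : \forall n \near \oo, x n != m.
  near=> n; rewrite -subr_eq0 addrK mulf_neq0// invr_neq0//.
  by apply: lt0r_neq0; near: n.
have xim : xi n @[n --> \oo] --> m.
  have x0 : `|x n - m| @[n --> \oo] --> (0 : R).
    rewrite -[X in _ --> X](normr0 R) -(subrr m).
    by apply: cvg_norm; apply: cvgB => //; exact: cvg_cst.
  apply: (@squeeze_cvgr _ _ _ _ (fun n => m - `|x n - m|) (fun n => m + `|x n -
    m|)).
  - near=> n; have [|_ + _] := xiP n; first by near: n.
    by rewrite ler_norml => /andP[? ?]; apply/andP; split; lra.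
  - by rewrite -[X in _ --> X]subr0; apply: cvgB => //; exact: cvg_cst.
  - by rewrite -[X in _ --> X]addr0; apply: cvgD => //; exact: cvg_cst.
have h : r (xi n) * y ^+ 2 / 2 @[n --> \oo] --> c * y ^+ 2 / 2.
  apply: cvgM; last exact: cvg_cst.
  apply: cvgM; last exact: cvg_cst.
  apply: diff_quotient_cvg => //.
  by near=> n; have [|] := xiP n => //; near: n.
apply: cvg_trans h; apply: near_eq_cvg; near=> n.
have an : 0 < a n by near: n.
have [|_ _ ->] := xiP n; first by near: n.
by rewrite /x addrK; move: (r _) => z; field; rewrite gt_eqF.
Unshelve. all: by end_near. Qed.

End scaled_increments.

Section mixture_llt.
Context {R : realType}.
Local Notation mu := (@lebesgue_measure R).

(** The set [X] selects the neighbourhood of one minimizer when [psi] has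
    several. *)
Definition mixing_weight (psi : R -> R) (X : set R) (N : nat) (x : R) : R :=
  expR (- (N%:R * psi x)) * \1_X x.

Definition mixture_pmf (psi p : R -> R) (X : set R) (N k j : nat) : R :=
  (\int[mu]_x (binomial_pmf k (p x) j * mixing_weight psi X N x)) /
  \int[mu]_x mixing_weight psi X N x.

Lemma mixing_weight_ge0 psi X N x : 0 <= mixing_weight psi X N x.
Proof. by rewrite mulr_ge0 ?expR_ge0. Qed.

Lemma measurable_mixing_weight psi X N :
  measurable_fun [set: R] psi -> measurable X ->
  measurable_fun [set: R] (mixing_weight psi X N).
Proof.
move=> mpsi mX; apply: measurable_funM => //.
apply: measurableT_comp => //; apply: measurableT_comp => //.
exact: measurable_funM.
Qed.

Variables (psi dpsi p : R -> R) (X : set R) (m kappa c d : R).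
Hypotheses (dpsiE : forall x : R, is_derive x 1 psi (dpsi x))
  (dpsim : dpsi m = 0) (ddpsi : is_derive m 1 dpsi kappa) (kappa0 : 0 < kappa).
Hypotheses (mX : measurable X) (Xm : nbhs m X) (c0 : 0 < c)
  (psi_ge : forall x, X x -> c * (x - m) ^+ 2 <= psi x - psi m).
Hypotheses (mp : measurable_fun [set: R] p) (p01 : forall x, 0 < p x < 1)
  (dp : is_derive m 1 p d).

Let cpsi : continuous psi.
Proof.
move=> x; apply/differentiable_continuous/derivable1_diffP.
exact: (@ex_derive _ _ _ _ _ _ _ (dpsiE x)).
Qed.

Let mpsi : measurable_fun [set: R] psi.
Proof. exact: continuous_measurable_fun. Qed.

Let b (N : nat) : R := Num.sqrt N%:R.

Let boo : b n @[n --> \oo] --> +oo.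
Proof. exact: (@cvg_sqrtn R id). Qed.

Let b_gt0 : \forall n \near \oo, 0 < b n.
Proof. by have /cvgryPgt := boo; apply. Qed.

(** The weight at [x], divided by its value at [m], in the variable
    [y = b N * (x - m)]. *)
Let u N y := expR (- (N%:R * (psi ((b N)^-1 * y + m) - psi m))) *
  \1_X ((b N)^-1 * y + m).

Let measurable_rescale N : measurable_fun [set: R] (fun y : R => (b N)^-1 * y + m).
Proof. by apply: measurable_funD => //; exact: measurable_funM. Qed.

Let measurable_u N : measurable_fun [set: R] (u N).
Proof.
apply: measurable_funM; last first.
  by apply: (measurableT_comp _ (measurable_rescale N)); exact: measurable_indic.
apply: measurableT_comp => //; apply: measurableT_comp => //.
apply: measurable_funM => //; apply: measurable_funB => //.
exact: measurableT_comp.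
Qed.

Let u_cvg y : u n y @[n --> \oo] --> expR (- (y ^+ 2 / (2 * kappa^-1))).
Proof.
have -> : y ^+ 2 / (2 * kappa^-1) = kappa * y ^+ 2 / 2.
  by field; rewrite gt_eqF.
have h : expR (- (b n ^+ 2 * (psi ((b n)^-1 * y + m) - psi m))) @[n --> \oo]
    --> expR (- (kappa * y ^+ 2 / 2)).
  apply: (@cvg_comp _ _ _ _ expR _ (nbhs (- (kappa * y ^+ 2 / 2))));
    last exact: continuous_expR.
  by apply: cvgN; exact: scaled_minimum_cvg.
apply: cvg_trans h; apply: near_eq_cvg; near=> n.
rewrite /u indicE mem_set ?mulr1 ?sqr_sqrtr//.
by near: n; exact: scaled_cvg0.
Unshelve. all: by end_near. Qed.

Let u_le : \forall n \near \oo, forall y,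
  `|u n y| <= expR (- ((y - 0) ^+ 2 / (2 * (2 * c)^-1))).
Proof.
near=> n; move=> y; have bn : 0 < b n by near: n.
rewrite ger0_norm ?mulr_ge0 ?expR_ge0// /u indicE.
case: (boolP (_ \in X)) => [|_]; last by rewrite mulr0 expR_ge0.
rewrite inE => /psi_ge; rewrite mulr1 ler_expR lerN2 addrK => h.
have -> : n%:R = b n ^+ 2 by rewrite sqr_sqrtr.
have -> : (y - 0) ^+ 2 / (2 * (2 * c)^-1) = b n ^+ 2 * (c * ((b n)^-1 * y) ^+ 2).
  by field; rewrite !gt_eqF.
by rewrite ler_wpM2l ?sqr_ge0.
Unshelve. all: by end_near. Qed.

Let g_int : mu.-integrable [set: R]
  (EFin \o (fun y => expR (- ((y - 0) ^+ 2 / (2 * (2 * c)^-1))))).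
Proof. by apply: integrable_expR_gauss; rewrite invr_gt0 mulr_gt0. Qed.

Let u_int_cvg : \int[mu]_y u n y @[n --> \oo] --> Num.sqrt (2 * pi * kappa^-1).
Proof.
rewrite -(@integral_expR_gauss R kappa^-1 0) ?invr_gt0//.
apply: (Rintegral_dominated_cvg measurable_u _ _ g_int u_le).
  have := @integrable_expR_gauss R kappa^-1 0.
  by rewrite invr_gt0 => /(_ kappa0) /(measurable_int mu) /measurable_EFinP.
by move=> y; rewrite subr0; exact: u_cvg.
Qed.

Variables (k j : nat -> nat) (alpha t : R).
Hypotheses (koo : k @ \oo --> \oo)
  (kalpha : ((k n)%:R / n%:R : R) @[n --> \oo] --> alpha).
Let a n : R := Num.sqrt (k n)%:R.
Hypothesis jt : a n * ((j n)%:R / (k n)%:R - p m) @[n --> \oo] --> t.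

Let v := p m * (1 - p m).

Let v0 : 0 < v.
Proof. by case/andP: (p01 m) => ? ?; rewrite mulr_gt0// subr_gt0. Qed.

Let p_cvg y : a n * (p ((b n)^-1 * y + m) - p m) @[n --> \oo] -->
  Num.sqrt alpha * (d * y).
Proof.
have h : Num.sqrt ((k n)%:R / n%:R) * (b n * (p ((b n)^-1 * y + m) - p m))
    @[n --> \oo] --> Num.sqrt alpha * (d * y).
  apply: cvgM; last exact: scaled_increment_cvg.
  apply: (@cvg_comp _ _ _ _ Num.sqrt _ (nbhs alpha)) => //.
  exact: sqrt_continuous.
apply: cvg_trans h; apply: near_eq_cvg; near=> n.
have bn : 0 < b n by near: n.
rewrite sqrtrM// sqrtrV// mulrA -[_ / _ * _]mulrA mulVf ?mulr1//.
by rewrite gt_eqF.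
Unshelve. all: by end_near. Qed.

Let integrand n y := a n * binomial_pmf (k n) (p ((b n)^-1 * y + m)) (j n) * u n y.

Let pmf_ge0 n x : 0 <= binomial_pmf (k n) (p x) (j n).
Proof. by apply: binomial_pmf_ge0; case/andP: (p01 x) => ? ?; rewrite !ltW. Qed.

Let mpmf n : measurable_fun [set: R] (fun x => binomial_pmf (k n) (p x) (j n)).
Proof. exact: (measurableT_comp (@measurable_binomial_pmf R setT (k n) (j n))
  mp). Qed.

Let integrand_cvg : \int[mu]_y integrand n y @[n --> \oo] -->
  Num.sqrt (2 * pi * kappa^-1) *
  normal_pdf 0 (Num.sqrt (v + (Num.sqrt alpha * d) ^+ 2 * kappa^-1)) t.
Proof.
rewrite -integral_normal_pdf_mix ?invr_gt0//.
have [B Bn] := binomial_pmf_bounded koo (p01 m) jt.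
apply: (@Rintegral_dominated_cvg _ _ _
  (fun y => B * expR (- ((y - 0) ^+ 2 / (2 * (2 * c)^-1))))).
- move=> n; apply: measurable_funM => //; apply: measurable_funM => //.
  exact: (measurableT_comp (mpmf n)).
- apply: measurable_funM.
    apply: measurableT_comp; first exact: measurable_normal_pdf.
    by apply: measurable_funB => //; exact: measurable_funM.
  apply: measurableT_comp => //; apply: measurableT_comp => //.
  by apply: measurable_funM => //; exact: measurable_funX.
- move=> y; apply: cvgM; last exact: u_cvg.
  rewrite -mulrA; apply: binomial_llt => //.
  by move=> n; case/andP: (p01 ((b n)^-1 * y + m)) => ? ?; rewrite !ltW.
- by have := integrableZl measurableT B g_int.
- near=> n; move=> y.
  rewrite normrM ger0_norm ?mulr_ge0 ?sqrtr_ge0//.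
  apply: ler_pM => //.
  + by rewrite mulr_ge0 ?sqrtr_ge0.
  + have x01 : 0 <= p ((b n)^-1 * y + m) <= 1.
      by case/andP: (p01 ((b n)^-1 * y + m)) => ? ?; rewrite !ltW.
    by move: (p _) x01; near: n.
  + by move: y; near: n.
Unshelve. all: by end_near. Qed.

(** The mixing variable fluctuates around [m] like a Gaussian of variance
    [1 / (n * kappa)]. This moves the mean [k * p x] by an amount of order
    [k / sqrt n], which is comparable to [sqrt k] when [k / n] has a positive
    limit. The mixture then adds [alpha * d ^+ 2 / kappa] to the variance
    [p m * (1 - p m)] of the binomial law. *)
Lemma mixture_llt :
  a n * mixture_pmf psi p X n (k n) (j n) @[n --> \oo] -->
  normal_pdf 0 (Num.sqrt (p m * (1 - p m) + alpha * d ^+ 2 / kappa)) t.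
Proof.
have s0 : Num.sqrt (2 * pi * kappa^-1) != 0.
  by rewrite gt_eqF// sqrtr_gt0 mulr_gt0 ?invr_gt0// mulr_gt0// pi_gt0.
have h : \int[mu]_y integrand n y / \int[mu]_y u n y @[n --> \oo] -->
  Num.sqrt (2 * pi * kappa^-1) *
  normal_pdf 0 (Num.sqrt (v + (Num.sqrt alpha * d) ^+ 2 * kappa^-1)) t /
  Num.sqrt (2 * pi * kappa^-1).
  by apply: cvgM => //; exact: cvgV.
have alpha0 : 0 <= alpha.
  rewrite -(cvg_lim _ kalpha)//; apply: limr_ge; first exact: cvgP kalpha.
  by apply: nearW => n; rewrite divr_ge0.
rewrite mulrAC divff// mul1r exprMn sqr_sqrtr// in h.
have a_gt0 : \forall n \near \oo, 0 < a n.
  by have /cvgryPgt : a n @[n --> \oo] --> +oo by exact: cvg_sqrtn.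
apply: cvg_trans h; apply: near_eq_cvg; near=> n.
have bn : 0 < b n by near: n.
have bV0 : (b n)^-1 != 0 by rewrite invr_neq0// gt_eqF.
have wE y : mixing_weight psi X n ((b n)^-1 * y + m) =
    expR (- (n%:R * psi m)) * u n y.
  by rewrite /mixing_weight /u mulrA -expRD; congr (expR _ * _); ring.
have mw := measurable_mixing_weight n mpsi mX.
have mbin : measurable_fun [set: R]
    (fun y => binomial_pmf (k n) (p ((b n)^-1 * y + m)) (j n)).
  exact: (measurableT_comp (mpmf n)).
pose e : R := `|(b n)^-1| * expR (- (n%:R * psi m)).
have denE : \int[mu]_x mixing_weight psi X n x = e * \int[mu]_y u n y.
  rewrite (Rintegral_affine m bV0 mw) => [|x]; last exact: mixing_weight_ge0.
  under eq_Rintegral do rewrite wE.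
  rewrite ge0_RintegralZl ?expR_gt0// ?mulrA// => y.
  by rewrite mulr_ge0 ?expR_ge0.
have numE : \int[mu]_x (binomial_pmf (k n) (p x) (j n) * mixing_weight psi X n x) =
    e * \int[mu]_y (binomial_pmf (k n) (p ((b n)^-1 * y + m)) (j n) * u n y).
  rewrite (Rintegral_affine m bV0); last 2 first.
  - exact: measurable_funM.
  - by move=> x; rewrite mulr_ge0 ?mixing_weight_ge0.
  under eq_Rintegral do rewrite wE mulrCA.
  rewrite ge0_RintegralZl ?expR_gt0 ?mulrA//; first exact: measurable_funM.
  by move=> y; rewrite !mulr_ge0 ?expR_ge0.
have inE : \int[mu]_y integrand n y =
    a n * \int[mu]_y (binomial_pmf (k n) (p ((b n)^-1 * y + m)) (j n) * u n y).
  rewrite -ge0_RintegralZl.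
  - by apply: eq_Rintegral => y _; rewrite mulrA.
  - by near: n.
  - exact: measurable_funM.
  - by move=> y; rewrite !mulr_ge0 ?expR_ge0.
rewrite /mixture_pmf numE denE inE -mulf_div mulfV ?mul1r ?mulrA//.
by rewrite mulf_neq0 ?normr_eq0// gt_eqF// expR_gt0.
Unshelve. all: by end_near. Qed.

End mixture_llt.

(** * From local limits to l1 distances *)

Section scheffe.
Context {R : realType}.
Local Notation mu := (@lebesgue_measure R).

(** The positive part of [f - f_ n] is dominated by [f], so its integral tends
    to 0; as [f_ n] has no more mass than [f], the integral of the negative part
    is at most that of the positive part. *)
Lemma scheffe (f_ : nat -> R -> R) (f : R -> R) :
  (forall n, mu.-integrable [set: R] (EFin \o f_ n)) ->
  mu.-integrable [set: R] (EFin \o f) ->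
  (forall n x, 0 <= f_ n x) -> (forall x, 0 <= f x) ->
  (forall x, f_ n x @[n --> \oo] --> f x) ->
  (forall n, \int[mu]_x f_ n x <= \int[mu]_x f x) ->
  \int[mu]_x `|f_ n x - f x| @[n --> \oo] --> 0.
Proof.
move=> if_ i_f f_0 f0 ff le_int.
have mf_ n : measurable_fun [set: R] (f_ n).
  by have /measurable_int/measurable_EFinP := if_ n.
have mf : measurable_fun [set: R] f by have /measurable_int/measurable_EFinP := i_f.
pose g (n : nat) (x : R) : R := Num.max (f x - f_ n x) 0.
have mg n : measurable_fun [set: R] (g n).
  by apply: measurable_maxr => //; exact: measurable_funB.
have gf n x : `|g n x| <= f x.
  rewrite /g ger0_norm ?le_max ?lexx ?orbT// ge_max f0 andbT.
  by rewrite gerBl.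
have ig n : mu.-integrable [set: R] (EFin \o g n).
  apply: (le_integrable measurableT _ _ i_f).
    by apply/measurable_EFinP; exact: mg.
  by move=> x _; rewrite lee_fin/= (ger0_norm (f0 x)).
have g0 : \int[mu]_x g n x @[n --> \oo] --> \int[mu]_x (0 : R).
  apply: (Rintegral_dominated_cvg mg _ _ i_f); first exact: measurable_cst.
    move=> x; apply: (@squeeze_cvgr _ _ _ _ (cst 0) (fun n => `|f x - f_ n x|)).
    - by apply: nearW => n; rewrite /g le_max lexx orbT ge_max ler_norm/=.
    - exact: cvg_cst.
    - rewrite -(normr0 R) -(subrr (f x)).
      by apply: cvg_norm; apply: cvgB => //; exact: cvg_cst.
  by apply: nearW => n x.
rewrite Rintegral_cst// mul0r in g0.
have absE n x : `|f_ n x - f x| = f_ n x - f x + 2 * g n x.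
  rewrite /g; have [h|h] := leP (f x - f_ n x) 0; rewrite ?mulr0 ?addr0.
    by rewrite ger0_norm//; lra.
  by rewrite ler0_norm; lra.
have le2 n : \int[mu]_x `|f_ n x - f x| <= 2 * \int[mu]_x g n x.
  under eq_Rintegral do rewrite absE.
  rewrite RintegralD//=; last 2 first.
  - by apply: (eq_integrable _ _ _ _ (integrableB measurableT (if_ n) i_f)).
  - by have := integrableZl measurableT 2 (ig n).
  rewrite RintegralB// RintegralZl//.
  by rewrite gerDr subr_le0.
apply: (@squeeze_cvgr _ _ _ _ (cst 0) (fun n => 2 * \int[mu]_x g n x)).
- by apply: nearW => n; rewrite le2 andbT Rintegral_ge0.
- exact: cvg_cst.
- by rewrite -(mulr0 2); apply: cvgM => //; exact: cvg_cst.
Qed.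

End scheffe.

Section step_function.
Context {R : realType}.
Local Notation mu := (@lebesgue_measure R).

(** The density of the lattice law [a], centred at [k * p] and rescaled by
    [sqrt k], when each atom is spread over an interval of length
    [1 / sqrt k]. *)
Definition step_fun (k : nat) (p : R) (a : nat -> R) (t : R) : R :=
  \sum_(j < k.+1) Num.sqrt k%:R * a j *
    \1_(`[(j%:R - k%:R * p) / Num.sqrt k%:R,
          (j.+1%:R - k%:R * p) / Num.sqrt k%:R[%classic) t.

Lemma step_funE k p a t : (0 < k)%N ->
  let z := k%:R * p + Num.sqrt k%:R * t in
  step_fun k p a t =
  if (0 <= z) && (Num.truncn z <= k)%N then Num.sqrt k%:R * a (Num.truncn z)
  else 0.
Proof.
move=> k0 z.
have s0 : 0 < Num.sqrt (k%:R : R) by rewrite sqrtr_gt0 ltr0n.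
have inE j : (t \in `[(j%:R - k%:R * p) / Num.sqrt k%:R,
          (j.+1%:R - k%:R * p) / Num.sqrt k%:R[%classic) = (j%:R <= z < j.+1%:R).
  rewrite mem_setE in_itv/= ler_pdivrMr// ltr_pdivlMr// lerBlDl ltrBrDl.
  by rewrite (mulrC t).
rewrite /step_fun; under eq_bigr do rewrite indicE inE.
case: ifPn => [/andP[z0 zk]|].
  rewrite (bigD1 (Ordinal (zk : (Num.truncn z < k.+1)%N)))//= big1 ?addr0.
    by rewrite truncn_itv// mulr1.
  move=> i iz; rewrite (_ : (_ <= z < _) = false) ?mulr0//.
  apply: contraNF iz => /andP[iz zi]; apply/eqP/val_inj => /=.
  by apply/esym/eqP; rewrite (truncn_eq _ z0) iz zi.
rewrite negb_and -ltNge -ltnNge => /orP zN.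
apply: big1 => i _; rewrite (_ : (_ <= z < _) = false) ?mulr0//.
apply/negP => /andP[iz zi].
have z0 : 0 <= z by rewrite (le_trans _ iz).
case: zN => [|]; first by rewrite ltNge z0.
have -> : Num.truncn z = i by apply/eqP; rewrite (truncn_eq _ z0) iz zi.
by rewrite ltnNge -ltnS ltn_ord.
Qed.

Lemma step_fun_ge0 k p a t : (forall j, 0 <= a j) -> 0 <= step_fun k p a t.
Proof. by move=> a0; apply: sumr_ge0 => j _; rewrite !mulr_ge0. Qed.

Lemma step_fun_normB k p a b t : (0 < k)%N ->
  `|step_fun k p a t - step_fun k p b t| = step_fun k p (fun j => `|a j - b j|) t.
Proof.
move=> k0; rewrite !step_funE//; case: ifPn => _; last by rewrite subrr normr0.
by rewrite -mulrBr normrM ger0_norm.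
Qed.

Lemma integrable_step_fun k p a : mu.-integrable [set: R] (EFin \o step_fun k p a).
Proof.
have -> : EFin \o step_fun k p a = (fun t => \sum_(j < k.+1)
   (Num.sqrt k%:R * a j *
    \1_(`[(j%:R - k%:R * p) / Num.sqrt k%:R,
          (j.+1%:R - k%:R * p) / Num.sqrt k%:R[%classic) t)%:E)%E.
  by apply/funext => t; rewrite /= /step_fun sumEFin.
apply: integrable_sum => // j _.
exact: (integrableZl measurableT _ (integrable_indic_itv _ _ true true)).
Qed.

Lemma Rintegral_step_fun k p a : (0 < k)%N ->
  \int[mu]_t step_fun k p a t = \sum_(j < k.+1) a j.
Proof.
move=> k0; have s0 : 0 < Num.sqrt (k%:R : R) by rewrite sqrtr_gt0 ltr0n.
rewrite /step_fun Rintegral_sum => [|j]; last first.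
  exact: (integrableZl measurableT _ (integrable_indic_itv _ _ true true)).
apply: eq_bigr => j _.
rewrite RintegralZl//; last exact: (integrable_indic_itv _ _ true true).
rewrite /Rintegral integral_indic// setIT.
transitivity (Num.sqrt k%:R * a j * (Num.sqrt k%:R)^-1).
  congr (_ * _); rewrite -[RHS]/(fine ((Num.sqrt k%:R)^-1)%:E); congr fine.
  apply: (etrans (lebesgue_measure_itv _)); rewrite /= lte_fin.
  rewrite ltr_pM2r ?invr_gt0// ltrD2r ltr_nat ltnSn -EFinB -natr1.
  by congr EFin; ring.
by rewrite mulrAC mulfV ?mul1r// gt_eqF.
Qed.

Section limit.
Variables (k : nat -> nat) (p : R) (a : nat -> nat -> R) (phi : R -> R).
Hypotheses (koo : k @ \oo --> \oo) (p01 : 0 < p < 1).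
Hypothesis a_ge0 : forall n j, 0 <= a n j.
Hypothesis a_le1 : forall n, \sum_(j < (k n).+1) a n j <= 1.
Hypothesis phi_ge0 : forall t, 0 <= phi t.
Hypothesis phi_int : mu.-integrable [set: R] (EFin \o phi).
Hypothesis phi1 : \int[mu]_t phi t = 1.

(** Convergence along every sequence of lattice points at rescaled distance [t]
    from [k * p]; rounding then gives the pointwise convergence of the step
    densities. *)
Definition local_limit :=
  forall (j : nat -> nat) (t : R),
    Num.sqrt (k n)%:R * ((j n)%:R / (k n)%:R - p) @[n --> \oo] --> t ->
    Num.sqrt (k n)%:R * a n (j n) @[n --> \oo] --> phi t.
Hypothesis a_lim : local_limit.

Let soo : Num.sqrt (k n)%:R @[n --> \oo] --> (+oo : set_system R).
Proof. exact: cvg_sqrtn. Qed.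

Let s_gt0 : \forall n \near \oo, 0 < Num.sqrt (k n)%:R :> R.
Proof. by have /cvgryPgt := soo. Qed.

Let z (n : nat) (t : R) : R := (k n)%:R * p + Num.sqrt (k n)%:R * t.

Let z_ge0 t : \forall n \near \oo, 0 <= z n t.
Proof.
case/andP: p01 => p0 _; near=> n.
have sn : 0 < Num.sqrt (k n)%:R :> R by near: n.
have : `|t| / p <= Num.sqrt (k n)%:R by near: n; have /cvgryPge := soo.
rewrite ler_pdivrMr// => h.
have -> : z n t = Num.sqrt (k n)%:R * (Num.sqrt (k n)%:R * p + t).
  by rewrite mulrDr mulrA -expr2 sqr_sqrtr.
by rewrite mulr_ge0 ?sqrtr_ge0//; have := lerNnormlW (lexx `|t|); lra.
Unshelve. all: by end_near. Qed.

Let trunc_z_cvg t :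
  Num.sqrt (k n)%:R * ((Num.truncn (z n t))%:R / (k n)%:R - p) @[n --> \oo] --> t.
Proof.
have sV : (Num.sqrt (k n)%:R)^-1 @[n --> \oo] --> (0 : R) by apply/gtr0_cvgV0.
apply: (@squeeze_cvgr _ _ _ _ (fun n => t - (Num.sqrt (k n)%:R)^-1) (cst t)).
- near=> n.
  have sn : 0 < Num.sqrt (k n)%:R :> R by near: n.
  have zn : 0 <= z n t by near: n.
  have /andP[z1 z2] := truncn_itv zn.
  move: z1 z2; rewrite /z -natr1; move: (Num.truncn _)%:R => j.
  have -> : (k n)%:R = Num.sqrt (k n)%:R ^+ 2 :> R by rewrite sqr_sqrtr.
  rewrite sqrtr_sqr ger0_norm; last exact: ltW.
  move: (Num.sqrt _) sn => s s0 z1 z2 /=.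
  have -> : s * (j / s ^+ 2 - p) = (j - s ^+ 2 * p) / s.
    by field; rewrite gt_eqF.
  rewrite ler_pdivrMr// ler_pdivlMr// mulrBl mulVf ?gt_eqF//.
  by apply/andP; split; lra.
- by rewrite -[X in _ --> X]subr0; apply: cvgB => //; exact: cvg_cst.
- exact: cvg_cst.
Unshelve. all: by end_near. Qed.

Let step_cvg t : step_fun (k n) p (a n) t @[n --> \oo] --> phi t.
Proof.
case/andP: (p01) => _ p1.
have h := a_lim (@trunc_z_cvg t).
have zk := cvg_of_scaled soo (@trunc_z_cvg t).
apply: cvg_trans h; apply: near_eq_cvg; near=> n.
have sn : 0 < Num.sqrt (k n)%:R :> R by near: n.
have kn : (0 : R) < (k n)%:R by rewrite -sqrtr_gt0.
rewrite step_funE; last by rewrite -(ltr0n R).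
have -> : 0 <= (k n)%:R * p + Num.sqrt (k n)%:R * t by near: n; exact: z_ge0.
have : (Num.truncn (z n t))%:R / (k n)%:R < 1 :> R.
  by near: n; exact: (cvgr_lt _ zk).
by rewrite ltr_pdivrMr// mul1r ltr_nat => /ltnW ->.
Unshelve. all: by end_near. Qed.

Let k_gt0 : \forall n \near \oo, (0 < k n)%N.
Proof. by have /cvgnyPgt := koo; apply. Qed.

Lemma step_fun_L1 :
  \int[mu]_t `|step_fun (k n) p (a n) t - phi t| @[n --> \oo] --> 0.
Proof.
have [N _ kN] := k_gt0.
rewrite -(cvg_shiftn N); apply: scheffe => //.
- by move=> n; exact: integrable_step_fun.
- by move=> n t; exact: step_fun_ge0.
- by move=> t; rewrite (cvg_shiftn N (fun n => step_fun (k n) p (a n) t)).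
- by move=> n; rewrite Rintegral_step_fun ?phi1//; apply: kN => /=;
    rewrite leq_addl.
Qed.

(** Applied to the restriction of a probability to a part of the lattice, this
    says that the rest of the lattice carries no mass in the limit. *)
Lemma local_limit_mass : \sum_(j < (k n).+1) a n j @[n --> \oo] --> (1 : R).
Proof.
have h : 1 - \int[mu]_t `|step_fun (k n) p (a n) t - phi t| @[n --> \oo] --> (1 -
  0 : R).
  by apply: cvgB; [exact: cvg_cst|exact: step_fun_L1].
rewrite subr0 in h.
apply: (@squeeze_cvgr _ _ _ _ _ (cst 1) _ _ _ h); last exact: cvg_cst.
near=> n; rewrite a_le1 andbT.
have kn : (0 < k n)%N by near: n.
rewrite -(Rintegral_step_fun p (a n) kn) -phi1.
have is_ := integrable_step_fun (k n) p (a n).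
rewrite lerBlDl -lerBlDr -RintegralB//.
apply: (le_trans (ler_norm _)); apply: (le_trans (le_normr_Rintegral _ _)) => //.
  exact: (integrableB measurableT phi_int is_).
by under eq_Rintegral do rewrite distrC.
Unshelve. all: by end_near. Qed.

End limit.

End step_function.

Section total_variation_limit.
Context {R : realType}.
Local Notation mu := (@lebesgue_measure R).

(** The l1 distance between two lattice laws is the L1 distance between their
    step densities, and each step density converges in L1. *)
Lemma local_limit_l1_dist (k : nat -> nat) (p : R) (a b : nat -> nat -> R)
    (phi psi : R -> R) :
  k @ \oo --> \oo -> 0 < p < 1 ->
  (forall n j, 0 <= a n j) -> (forall n j, 0 <= b n j) ->
  (forall n, \sum_(j < (k n).+1) a n j <= 1) ->
  (forall n, \sum_(j < (k n).+1) b n j <= 1) ->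
  (forall t, 0 <= phi t) -> (forall t, 0 <= psi t) ->
  mu.-integrable [set: R] (EFin \o phi) -> mu.-integrable [set: R] (EFin \o psi) ->
  \int[mu]_t phi t = 1 -> \int[mu]_t psi t = 1 ->
  local_limit k p a phi -> local_limit k p b psi ->
  \sum_(j < (k n).+1) `|a n j - b n j| @[n --> \oo] -->
  \int[mu]_t `|phi t - psi t|.
Proof.
move=> koo p01 a0 b0 a1 b1 phi0 psi0 iphi ipsi phi1 psi1 alim blim.
have La := step_fun_L1 koo p01 a0 a1 phi0 iphi phi1 alim.
have Lb := step_fun_L1 koo p01 b0 b1 psi0 ipsi psi1 blim.
pose A n := step_fun (k n) p (a n); pose B n := step_fun (k n) p (b n).
pose E n := \int[mu]_t `|A n t - phi t| + \int[mu]_t `|B n t - psi t|.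
have E0 : E n @[n --> \oo] --> (0 : R).
  by rewrite -[X in _ --> X](addr0 0); exact: cvgD La Lb.
have k_gt0 : \forall n \near \oo, (0 < k n)%N by have /cvgnyPgt := koo; apply.
have iA n : mu.-integrable [set: R] (EFin \o A n) by exact: integrable_step_fun.
have iB n : mu.-integrable [set: R] (EFin \o B n) by exact: integrable_step_fun.
have inorm (f g : R -> R) : mu.-integrable [set: R] (EFin \o f) ->
    mu.-integrable [set: R] (EFin \o g) ->
    mu.-integrable [set: R] (EFin \o (fun t => `|f t - g t|)).
  by move=> i_f i_g; exact: (integrable_norm (integrableB measurableT i_f i_g)).
have triangle (f1 f2 g1 g2 : R -> R) :
    mu.-integrable [set: R] (EFin \o f1) -> mu.-integrable [set: R] (EFin \o f2) ->
    mu.-integrable [set: R] (EFin \o g1) -> mu.-integrable [set: R] (EFin \o g2) ->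
    \int[mu]_t `|f1 t - f2 t| <= \int[mu]_t `|g1 t - g2 t| +
      (\int[mu]_t `|f1 t - g1 t| + \int[mu]_t `|f2 t - g2 t|).
  move=> if1 if2 ig1 ig2.
  have i1 := inorm _ _ if1 if2; have i2 := inorm _ _ ig1 ig2.
  have i3 := inorm _ _ if1 ig1; have i4 := inorm _ _ if2 ig2.
  have i5 : mu.-integrable [set: R]
      (EFin \o (fun t => `|f1 t - g1 t| + `|f2 t - g2 t|)).
    exact: (integrableD measurableT i3 i4).
  rewrite -RintegralD// -RintegralD//; apply: le_Rintegral => //.
    exact: (integrableD measurableT i2 i5).
  move=> t _.
  have -> : f1 t - f2 t = (g1 t - g2 t) + ((f1 t - g1 t) - (f2 t - g2 t)) by ring.
  apply: (le_trans (ler_normD _ _)); rewrite lerD2l.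
  exact: ler_normB.
apply: (@squeeze_cvgr _ _ _ _ (fun n => \int[mu]_t `|phi t - psi t| - E n)
  (fun n => \int[mu]_t `|phi t - psi t| + E n)).
- near=> n; have kn : (0 < k n)%N by near: n.
  rewrite -(Rintegral_step_fun p (fun j => `|a n j - b n j|) kn).
  have -> : \int[mu]_t step_fun (k n) p (fun j => `|a n j - b n j|) t =
      \int[mu]_t `|A n t - B n t|.
    by apply: eq_Rintegral => t _; rewrite /A /B step_fun_normB.
  rewrite (triangle (A n) (B n) phi psi)// andbT lerBlDr.
  apply: (le_trans (triangle phi psi (A n) (B n) _ _ _ _)) => //.
  rewrite lerD2l /E lerD//; apply: le_Rintegral => //; try exact: inorm.
  + by move=> t _; rewrite distrC.
  + by move=> t _; rewrite distrC.
- by rewrite -[X in _ --> X]subr0; apply: cvgB => //; exact: cvg_cst.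
- by rewrite -[X in _ --> X]addr0; apply: cvgD => //; exact: cvg_cst.
Unshelve. all: by end_near. Qed.

End total_variation_limit.

(** * Total variation between lattice laws *)

Section total_variation.
Context {R : realType}.

Definition lattice_law (k : nat) (a : nat -> R) (P : set R -> \bar R) :=
  forall A : set R, measurable A ->
    P A = (\sum_(j < k.+1 | j%:R \in A) a j)%:E.

(** As the differences [a j - b j] sum to 0, twice the difference of the
    probabilities of an event is the sum of the [a j - b j] with a minus sign
    outside of the event. This is largest for the event where [b j <= a j]. *)
Lemma dTV_lattice (k : nat) (a b : nat -> R) (P Q : {measure set R -> \bar R}) :
  lattice_law k a P -> lattice_law k b Q ->
  \sum_(j < k.+1) a j = \sum_(j < k.+1) b j ->
  dTV P Q = 2^-1 * \sum_(j < k.+1) `|a j - b j|.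
Proof.
move=> Pa Qb ab; pose d j := a j - b j.
have d0 : \sum_(j < k.+1) d j = 0 by rewrite sumrB ab subrr.
have dE A : measurable A ->
    fine (P A) - fine (Q A) = \sum_(j < k.+1 | j%:R \in A) d j.
  by move=> mA; rewrite Pa// Qb//= -sumrB.
have twice A : measurable A -> 2 * (fine (P A) - fine (Q A)) =
    \sum_(j < k.+1) (if j%:R \in A then d j else - d j).
  move=> mA; rewrite dE// [RHS](bigID (fun j : 'I_k.+1 => j%:R \in A))/=.
  under [X in _ = X + _]eq_bigr => j -> do [].
  under [X in _ = _ + X]eq_bigr => j /negbTE -> do [].
  rewrite sumrN; move: d0; rewrite (bigID (fun j : 'I_k.+1 => j%:R \in A))/=.
  lra.
have ubd A : measurable A ->
    `|fine (P A) - fine (Q A)| <= 2^-1 * \sum_(j < k.+1) `|d j|.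
  move=> mA; rewrite ler_pdivlMl// -[X in X * _](@ger0_norm _ 2)// -normrM twice//.
  apply: (le_trans (ler_norm_sum _ _ _)); apply: ler_sum => j _.
  by case: ifP => _; rewrite ?normrN.
pose A : set R := \bigcup_(j in [set j : nat | 0 <= d j]) [set j%:R].
have mA : measurable A.
  by apply: bigcup_measurable => j _; exact: measurable_set1.
have inA (j : 'I_k.+1) : (j%:R \in A) = (0 <= d j).
  apply/idP/idP; rewrite inE.
    by move=> [i /= di /eqP]; rewrite eqr_nat => /eqP ->.
  by move=> dj; exists j.
have attained : `|fine (P A) - fine (Q A)| = 2^-1 * \sum_(j < k.+1) `|d j|.
  apply/eqP; rewrite eq_le ubd//= ler_pdivrMl// (le_trans _ (ler_wpM2l _
    (ler_norm _)))//.
  rewrite twice//; apply: ler_sum => j _; rewrite inA; case: ifPn => dj.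
    by rewrite ger0_norm.
  by rewrite ler0_norm// ltW// ltNge.
rewrite /dTV; apply/eqP; rewrite eq_le; apply/andP; split.
  apply: ge_sup; first by exists `|fine (P A) - fine (Q A)|; exists A.
  by move=> _ [B mB <-]; exact: ubd.
rewrite -/(d _) -attained; apply: ub_le_sup; last by exists A.
by exists (2^-1 * \sum_(j < k.+1) `|d j|) => _ [B mB <-]; exact: ubd.
Qed.

Lemma esum_nat_support (k : nat) (a : nat -> R) (U : set nat) :
  (forall j, 0 <= a j) -> (forall j, (k < j)%N -> a j = 0) ->
  (\esum_(j in U) (a j)%:E = (\sum_(j < k.+1 | (j : nat) \in U) a j)%:E)%E.
Proof.
move=> a0 ak; have a0' j : (0 <= (a j)%:E)%E by rewrite lee_fin.
rewrite (esumID `I_k.+1)// [X in (_ + X)%E]esum1 ?adde0; last first.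
  by move=> j [_ /negP]; rewrite -leqNgt => /ak ->.
rewrite esum_mkcondl esum_fset//; last by move=> i /= _; case: ifPn.
rewrite -fsbig_ord//= [in RHS]big_mkcond/= -sumEFin; apply: eq_bigr => i _.
by case: ifP.
Qed.

Lemma Bin_lattice (n : nat) (p : R) : 0 <= p <= 1 ->
  lattice_law n (binomial_pmf n p) (Bin n p).
Proof.
move=> p01 A mA; rewrite /Bin /distribution /pushforward/= /binomial_prob p01.
rewrite (@esum_nat_support n); last 2 first.
- by move=> j; exact: binomial_pmf_ge0.
- by move=> j nj; rewrite /binomial_pmf bin_small.
by congr EFin; apply: eq_bigl => j; rewrite !inE.
Qed.

Lemma mixed_Bin_lattice (n : nat) (p q : R) : 0 <= p <= 1 -> 0 <= q <= 1 ->
  lattice_law n (fun j => 2^-1 * (binomial_pmf n p j + binomial_pmf n q j))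
    (mixed_Bin n (half_diracs p q)).
Proof.
move=> p01 q01 A mA; rewrite /mixed_Bin /pushforward/= /mixed_binomial_prob.
have mpmf D (j : nat) : measurable_fun D (fun x : R => (binomial_pmf n x j)%:E).
  by apply/measurable_EFinP; exact: measurable_binomial_pmf.
have pmf_ge0 (j : nat) (x : R) : `[0, 1]%classic x -> (0 <= (binomial_pmf n x
  j)%:E)%E.
  by rewrite /= in_itv/= => x01; rewrite lee_fin binomial_pmf_ge0.
have E j : (\int[half_diracs p q]_(x in `[0%R, 1%R]) (binomial_pmf n x j)%:E =
    (2^-1 * (binomial_pmf n p j + binomial_pmf n q j))%:E)%E.
  rewrite /half_diracs ge0_integral_mscale//=; last exact: pmf_ge0.
  rewrite ge0_integral_measure_add//=; last exact: pmf_ge0.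
  rewrite !integral_dirac//= !diracE !mem_set/= ?in_itv//=.
  by rewrite !mul1e -EFinD -EFinM.
under eq_esum do rewrite E.
rewrite (@esum_nat_support n); last 2 first.
- by move=> j; rewrite mulr_ge0 ?invr_ge0// addr_ge0// binomial_pmf_ge0.
- by move=> j nj; rewrite /binomial_pmf bin_small// !mulr0n addr0 mulr0.
by congr EFin; apply: eq_bigl => j; rewrite !inE.
Qed.

End total_variation.

(** * Hyperbolic tangent *)

Section hyperbolic_tangent.
Context {R : realType}.
Implicit Types (u v : R).

Lemma tanh_opp u : tanh (- u) = - tanh u.
Proof. by rewrite /tanh opprK -mulNr opprB (addrC (expR u)). Qed.

Lemma tanh0 : tanh (0 : R) = 0.
Proof. by rewrite /tanh oppr0 subrr mul0r. Qed.

Lemma tanh_lt1 u : tanh u < 1.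
Proof.
have a0 := expR_gt0 u; have b0 := expR_gt0 (- u).
by rewrite /tanh ltr_pdivrMr ?addr_gt0// mul1r; lra.
Qed.

Lemma tanh_gtN1 u : -1 < tanh u.
Proof. by have := tanh_lt1 (- u); rewrite tanh_opp; lra. Qed.

Lemma tanh_sqr_lt1 u : tanh u ^+ 2 < 1.
Proof. have := tanh_lt1 u; have := tanh_gtN1 u; rewrite expr2; nra. Qed.

Lemma is_derive_tanh (u : R) : is_derive u 1 (@tanh R) (1 - tanh u ^+ 2).
Proof.
have a0 := expR_gt0 u; have b0 := expR_gt0 (- u).
have ab : expR u + expR (- u) != 0 by rewrite gt_eqF// addr_gt0.
have d1 : is_derive u 1 (fun x : R => expR (- x)) (- expR (- u)).
  have := @is_derive1_comp R expR (fun x => - x) u _ _ (is_derive_expR (- u))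
    (is_deriveNid u 1).
  by rewrite mulrN1.
have d2 := is_derive_expR u.
have d3 := is_deriveB d2 d1; have d4 := is_deriveD d2 d1.
have d5 := @is_deriveV R (expR + (fun x : R => expR (- x))) u _ _ ab d4.
have d := is_deriveM d3 d5.
 apply: (is_derive_eq d).
rewrite !fctE /tanh /GRing.scale/=.
by move: (expR u) (expR (- u)) ab => a b ab; field.
Qed.

Lemma is_derive_tanh_affine (beta h x : R) :
  is_derive x 1 (fun x => tanh (beta * x + h)) (beta * (1 - tanh (beta * x + h)
    ^+ 2)).
Proof.
have d1 : is_derive x 1 (fun x : R => beta * x + h) beta.
  apply: is_derive_eq; rewrite /GRing.scale/=; ring.
have := @is_derive1_comp R (@tanh R) (fun x => beta * x + h) x _ _
  (is_derive_tanh (beta * x + h)) d1.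
by rewrite mulrC.
Qed.

Lemma tanh_increasing u v : u < v -> tanh u < tanh v.
Proof.
move=> uv; have [x _ E] := MVT_is_derive uv is_derive_tanh.
rewrite -subr_gt0 E mulr_gt0 ?subr_gt0//; exact: tanh_sqr_lt1.
Qed.

Lemma tanh_ge0 u : 0 <= u -> 0 <= tanh u.
Proof.
by rewrite le_eqVlt => /predU1P[<-|/tanh_increasing]; rewrite tanh0// => /ltW.
Qed.

End hyperbolic_tangent.

(** * The number of positive spins as a mixture of binomial laws *)

Section gibbs_mixture.
Context {R : realType}.
Local Notation mu := (@lebesgue_measure R).

Definition head_count (N k : nat) (s : config N) : nat :=
  #|[set j : 'I_N | (j < k)%N && s j]%SET|.

Lemma head_count_le (N k : nat) (s : config N) : (head_count k s <= k)%N.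
Proof.
rewrite /head_count cardE -(size_map val) -[leqRHS](size_iota 0).
apply: uniq_leq_size; first by rewrite map_inj_uniq ?enum_uniq//; exact: val_inj.
by move=> _ /mapP[i + ->]; rewrite mem_enum inE mem_iota => /andP[].
Qed.

Lemma gibbsE (N : nat) (beta h : R) (U : set (config N)) :
  gibbs beta h U = (\sum_(s : config N | s \in U)
    gibbs_weight beta h s / partition_function N beta h)%:E.
Proof.
have w0 (s : config N) :
    (0 <= (gibbs_weight beta h s / partition_function N beta h)%:E)%E.
  by rewrite lee_fin divr_ge0// ltW// ?gibbs_weight_gt0 ?partition_function_gt0.
rewrite /gibbs esum_mkcond esum_fset//; last 2 first.
- exact: finite_finset.
- by move=> s _ /=; case: ifP.
rewrite (@fsbigE _ _ _ _ _ (index_enum (config N))) ?index_enum_uniq//; last first.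
  by move=> s _ /negP[]; exact: mem_index_enum.
rewrite [in RHS]big_mkcond/= -sumEFin; under eq_bigl do rewrite in_setT.
by apply: eq_bigr => s _; case: ifP.
Qed.

Definition count_pmf (N k : nat) (beta h : R) (j : nat) : R :=
  \sum_(s : config N | head_count k s == j)
    gibbs_weight beta h s / partition_function N beta h.

Lemma plus_count_law_lattice (N k : nat) (beta h : R) :
  lattice_law k (count_pmf N k beta h) (plus_count_law N k beta h).
Proof.
move=> A mA.
rewrite /plus_count_law /distribution /pushforward/= gibbsE; congr EFin.
rewrite (partition_big (fun s => inord (head_count k s) : 'I_k.+1)
  (fun j : 'I_k.+1 => (j%:R : R) \in A))/=; last first.
  move=> s; rewrite !inE/= /plus_count inordK//.
  by rewrite ltnS head_count_le.
apply: eq_bigr => j jA; apply: eq_bigl => s.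
rewrite -val_eqE/= inordK ?ltnS ?head_count_le//.
rewrite andb_idl// => /eqP sj; rewrite inE/= /plus_count -/(head_count k s) sj.
by move: jA; rewrite inE.
Qed.

(** Both sides are the coefficient of ['X^j] in the product over the sites of
    [a * 'X + b] for the first [k] sites and [a + b] for the others. *)
Lemma sum_config_prod (N k j : nat) (a b : R) : (k <= N)%N ->
  \sum_(s : config N | head_count k s == j) \prod_(i < N) (if s i then a else b) =
  (a ^+ j * b ^+ (k - j) *+ 'C(k, j)) * (a + b) ^+ (N - k).
Proof.
move=> kN.
pose c (i : 'I_N) (e : bool) : {poly R} :=
  if e then a%:P * (if (i < k)%N then 'X else 1) else b%:P.
have termE (s : config N) : \prod_(i < N) c i (s i) =
    (\prod_(i < N) (if s i then a else b))%:P * 'X^(head_count k s).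
  have -> : 'X^(head_count k s) = \prod_(i < N) (if (i < k)%N && s i then 'X else
    1) :> {poly R}.
    rewrite -big_mkcond/= prodr_const /head_count; congr (_ ^+ _).
    by apply: eq_card => i; rewrite !inE.
  rewrite rmorph_prod -big_split/=; apply: eq_bigr => i _; rewrite /c.
  by case: (s i); rewrite ?andbT ?andbF ?mulr1.
have sumE : \sum_(s : config N) (\prod_(i < N) (if s i then a else b))%:P *
  'X^(head_count k s)
    = (a%:P * 'X + b%:P) ^+ k * ((a + b) ^+ (N - k))%:P.
  under eq_bigr do rewrite -termE.
  rewrite -(bigA_distr_bigA c).
  transitivity (\prod_(i < N) (if (i < k)%N then a%:P * 'X + b%:P else (a + b)%:P)).
    apply: eq_bigr => i _; rewrite big_bool /c/=.
    by case: ifP => _; rewrite ?mulr1// polyCD.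
  rewrite (bigID (fun i : 'I_N => (i < k)%N))/=.
  have cardk : #|[pred i : 'I_N | (i < k)%N]| = k.
    by rewrite -[RHS](card_ord k) -!sum1_card (big_ord_widen N (fun=> 1%N)).
  have cardNk : #|[pred i : 'I_N | ~~ (i < k)%N]| = (N - k)%N.
    rewrite -[in RHS](card_ord N) -(cardC [pred i : 'I_N | (i < k)%N]) cardk addKn.
    by apply: eq_card.
  congr (_ * _).
    under eq_bigr => i -> do [].
    by rewrite prodr_const cardk.
  under eq_bigr => i /negbTE -> do [].
  by rewrite prodr_const cardNk rmorphXn.
have /(congr1 (fun q : {poly R} => q`_j)) := sumE.
rewrite coef_sum coefMC => coefE.
transitivity (\sum_(s : config N)
    ((\prod_(i < N) (if s i then a else b))%:P * 'X^(head_count k s))`_j).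
  rewrite big_mkcond/=; apply: eq_bigr => s _.
  rewrite coefCM coefXn eq_sym; case: ifP => _; rewrite ?mulr1 ?mulr0//.
rewrite coefE; congr (_ * _).
rewrite addrC exprDn coef_sum.
under eq_bigr => i _ do
  rewrite exprMn -!rmorphXn/= mulrA -polyCM coefMn coefCM coefXn.
have [jk|kj] := leqP j k.
  rewrite (bigD1 (Ordinal (jk : (j < k.+1)%N)))//= eqxx mulr1 mulrC big1 ?addr0//.
  move=> i; rewrite -val_eqE/= eq_sym => /negbTE ->; by rewrite mulr0 mul0rn.
rewrite bin_small// mulr0n big1// => i _.
have /negbTE -> : j != i by rewrite neq_ltn orbC (leq_trans _ kj)// ltn_ord.
by rewrite mulr0 mul0rn.
Qed.

Definition log_partition (beta h x : R) : R :=
  ln (expR (beta * x + h) + expR (- (beta * x + h))).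

(** The critical points are the solutions of the mean-field equation
    [x = tanh (beta * x + h)]. *)
Definition free_energy (beta h x : R) : R :=
  beta * x ^+ 2 / 2 - log_partition beta h x.

(** The probability of a spin +1 at a single site in the field
    [beta * x + h]. *)
Definition plus_prob (beta h x : R) : R :=
  expR (beta * x + h) / (expR (beta * x + h) + expR (- (beta * x + h))).

(** The Hubbard-Stratonovich transformation: the exponential of the quadratic
    interaction is a Gaussian average over [x] of product weights, as one sees
    by completing the square around the mean spin [S / N]. *)
Lemma gibbs_weight_integral (N : nat) (beta h : R) (s : config N) :
  (0 < N)%N -> 0 < beta ->
  let F x := expR (- (N%:R * (beta * x ^+ 2 / 2))) *
    \prod_(i < N) (if s i then expR (beta * x + h) else expR (- (beta * x + h))) in
  mu.-integrable [set: R] (EFin \o F) /\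
  \int[mu]_x F x = Num.sqrt (2 * pi * (N%:R * beta)^-1) * gibbs_weight beta h s.
Proof.
move=> N0 beta0 F; have N0' : (0 : R) < N%:R by rewrite ltr0n.
have v0 : 0 < (N%:R * beta)^-1 by rewrite invr_gt0 mulr_gt0.
pose S : R := \sum_(i < N) spin s i.
have FE x : F x = gibbs_weight beta h s *
    expR (- ((x - S / N%:R) ^+ 2 / (2 * (N%:R * beta)^-1))).
  rewrite /F; have -> : \prod_(i < N) (if s i then expR (beta * x + h) else expR
    (- (beta * x + h)))
      = expR ((beta * x + h) * S).
    rewrite mulr_sumr expR_sum; apply: eq_bigr => i _; rewrite /spin.
    by case: (s i); rewrite ?mulr1// mulrN1.
  rewrite /gibbs_weight.
  have -> : \sum_(i < N) \sum_(j < N) spin s i * spin s j = S * S :> R.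
    by rewrite /S mulr_suml; apply: eq_bigr => i _; rewrite mulr_sumr.
  rewrite -/S -!expRD; congr expR.
  by field; rewrite !gt_eqF.
have FE' : F = (fun x => gibbs_weight beta h s *
    expR (- ((x - S / N%:R) ^+ 2 / (2 * (N%:R * beta)^-1)))).
  exact/funext.
have ig := integrable_expR_gauss (S / N%:R) v0.
rewrite FE'; split; first exact: (integrableZl measurableT (gibbs_weight beta h
  s) ig).
by rewrite RintegralZl// integral_expR_gauss// mulrC.
Qed.

Lemma plus_prob01 (beta h x : R) : 0 < plus_prob beta h x < 1.
Proof.
have a0 := expR_gt0 (beta * x + h); have b0 := expR_gt0 (- (beta * x + h)).
rewrite /plus_prob divr_gt0 ?addr_gt0//= ltr_pdivrMr ?addr_gt0// mul1r.
by rewrite ltrDl.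
Qed.

Lemma expR_free_energy (N : nat) (beta h x : R) :
  expR (- (N%:R * free_energy beta h x)) =
  expR (- (N%:R * (beta * x ^+ 2 / 2))) *
    (expR (beta * x + h) + expR (- (beta * x + h))) ^+ N.
Proof.
rewrite /free_energy mulrBr opprB addrC expRD expRM_natl lnK//.
by rewrite posrE addr_gt0 ?expR_gt0.
Qed.

Let site_weight (N : nat) (beta h : R) (s : config N) (x : R) : R :=
  expR (- (N%:R * (beta * x ^+ 2 / 2))) *
  \prod_(i < N) (if s i then expR (beta * x + h) else expR (- (beta * x + h))).

Let sum_site_weight (N k j : nat) (beta h x : R) : (k <= N)%N ->
  \sum_(s : config N | head_count k s == j) site_weight beta h s x =
  binomial_pmf k (plus_prob beta h x) j *
    mixing_weight (free_energy beta h) setT N x.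
Proof.
move=> kN; rewrite -mulr_sumr sum_config_prod//.
rewrite /mixing_weight indicE in_setT mulr1 expR_free_energy [RHS]mulrCA;
  congr (_ * _).
rewrite binomial_pmfE /plus_prob.
have e0 : 0 < expR (beta * x + h) + expR (- (beta * x + h)).
  by rewrite addr_gt0 ?expR_gt0.
move: (expR (beta * x + h)) (expR (- (beta * x + h))) e0 => a b ab0.
have -> : 1 - a / (a + b) = b / (a + b) by field; rewrite gt_eqF.
have [jk|kj] := leqP j k; last by rewrite bin_small// !mulr0n !mul0r.
rewrite -[in RHS](subnKC kN) exprD !expr_div_n.
rewrite -[in X in _ = _ * (X * _)](subnKC jk) exprD.
rewrite -[X in X * _ = _]mulr_natr -[X in _ = X * _]mulr_natr.
have := expf_neq0 j (lt0r_neq0 ab0); have := expf_neq0 (k - j) (lt0r_neq0 ab0).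
move: (_ ^+ j) (_ ^+ j) (_ ^+ (k - j)) (_ ^+ (k - j)) (_ ^+ (N - k)) (_%:R).
by move=> x1 x2 x3 x4 x5 x6 x40 x20; field; rewrite x40 x20.
Qed.

Let head_count0 (N : nat) (s : config N) : head_count 0 s = 0%N.
Proof. by apply/eqP; rewrite -leqn0 head_count_le. Qed.

Let mixing_weightE (N : nat) (beta h x : R) :
  mixing_weight (free_energy beta h) setT N x =
  \sum_(s : config N) site_weight beta h s x.
Proof.
have := @sum_site_weight N 0 0 beta h x (leq0n N).
under eq_bigl do rewrite head_count0 eqxx.
by move=> ->; rewrite binomial_pmfE !expr0 !mul1r.
Qed.

Lemma integrable_mixing_weight (N : nat) (beta h : R) :
  (0 < N)%N -> 0 < beta ->
  mu.-integrable [set: R] (EFin \o mixing_weight (free_energy beta h) setT N).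
Proof.
move=> N0 beta0.
have -> : EFin \o mixing_weight (free_energy beta h) setT N =
    (fun x => \sum_(s : config N) (site_weight beta h s x)%:E)%E.
  by apply/funext => x; rewrite /= mixing_weightE sumEFin.
apply: integrable_sum => // s _.
exact: (@gibbs_weight_integral N beta h s N0 beta0).1.
Qed.

Lemma sum_gibbs_weight (N k j : nat) (beta h : R) :
  (0 < N)%N -> (k <= N)%N -> 0 < beta ->
  Num.sqrt (2 * pi * (N%:R * beta)^-1) *
    (\sum_(s : config N | head_count k s == j) gibbs_weight beta h s) =
  \int[mu]_x (binomial_pmf k (plus_prob beta h x) j *
    mixing_weight (free_energy beta h) setT N x).
Proof.
move=> N0 kN beta0; rewrite mulr_sumr.
have E s := @gibbs_weight_integral N beta h s N0 beta0.
under eq_bigr do rewrite -(E _).2.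
rewrite -Rintegral_sum => [|s]; last exact: (E s).1.
by apply: eq_Rintegral => x _; exact: sum_site_weight.
Qed.

Lemma partition_function_integral (N : nat) (beta h : R) :
  (0 < N)%N -> 0 < beta ->
  Num.sqrt (2 * pi * (N%:R * beta)^-1) * partition_function N beta h =
  \int[mu]_x mixing_weight (free_energy beta h) setT N x.
Proof.
move=> N0 beta0.
have := @sum_gibbs_weight N 0 0 beta h N0 (leq0n N) beta0.
under eq_bigl do rewrite head_count0 eqxx.
move=> ->; apply: eq_Rintegral => x _.
by rewrite /binomial_pmf !expr0 !mul1r.
Qed.

(** Under the product weights of [gibbs_weight_integral] the spins are
    independent, so their contribution for fixed [x] is a binomial mass. *)
Lemma count_pmf_mixture (N k j : nat) (beta h : R) :
  (0 < N)%N -> (k <= N)%N -> 0 < beta ->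
  count_pmf N k beta h j =
  mixture_pmf (free_energy beta h) (plus_prob beta h) setT N k j.
Proof.
move=> N0 kN beta0; rewrite /mixture_pmf -partition_function_integral//.
rewrite -sum_gibbs_weight// -mulf_div mulfV ?mul1r; last first.
  rewrite gt_eqF// sqrtr_gt0 mulr_gt0// ?mulr_gt0 ?pi_gt0//.
  by rewrite invr_gt0 mulr_gt0// ltr0n.
by rewrite /count_pmf mulr_suml.
Qed.

Lemma count_pmf_ge0 (N k j : nat) (beta h : R) : 0 <= count_pmf N k beta h j.
Proof.
apply: sumr_ge0 => s _.
by rewrite divr_ge0// ltW// ?gibbs_weight_gt0 ?partition_function_gt0.
Qed.

Lemma sum_count_pmf (N k : nat) (beta h : R) :
  \sum_(j < k.+1) count_pmf N k beta h j = 1.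
Proof.
apply: EFin_inj.
have := plus_count_law_lattice N k beta h (@measurableT _ R).
rewrite probability_setT => ->; congr EFin.
by apply: eq_bigl => j; rewrite in_setT.
Qed.

Lemma plus_prob_tanh (beta h x : R) :
  plus_prob beta h x = (1 + tanh (beta * x + h)) / 2.
Proof.
rewrite /plus_prob /tanh; field.
by rewrite gt_eqF// addr_gt0 ?expR_gt0.
Qed.

Lemma is_derive_plus_prob (beta h x : R) :
  is_derive x 1 (plus_prob beta h) (beta * (1 - tanh (beta * x + h) ^+ 2) / 2).
Proof.
have -> : plus_prob beta h = (fun x => (1 + tanh (beta * x + h)) / 2).
  by apply/funext => y; exact: plus_prob_tanh.
have d1 := is_derive_tanh_affine beta h x.
by apply: is_derive_eq; rewrite /GRing.scale/=; ring.
Qed.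

Lemma is_derive_free_energy (beta h x : R) :
  is_derive x 1 (free_energy beta h) (beta * (x - tanh (beta * x + h))).
Proof.
have d1 : is_derive x 1 (fun x : R => beta * x + h) beta.
  by apply: is_derive_eq; rewrite /GRing.scale/=; ring.
have d2 := @is_derive1_comp R expR (fun x => beta * x + h) x _ _ (is_derive_expR
  (beta * x + h)) d1.
have d3 : is_derive x 1 (fun x : R => - (beta * x + h)) (- beta) by exact:
  is_deriveN.
have d4 := @is_derive1_comp R expR (fun x => - (beta * x + h)) x _ _
  (is_derive_expR (- (beta * x + h))) d3.
have e0 : 0 < expR (beta * x + h) + expR (- (beta * x + h)).
  by rewrite addr_gt0 ?expR_gt0.
have d5 := @is_derive1_comp R (@ln R) _ x _ _ (is_derive1_ln e0) (is_deriveD d2 d4).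
have d6 : is_derive x 1 (log_partition beta h) (beta * tanh (beta * x + h)).
  apply: (is_derive_eq d5); rewrite /tanh; field.
  by rewrite gt_eqF.
by apply: is_derive_eq; rewrite /GRing.scale/=; field.
Qed.

Let derivable_measurable (f f' : R -> R) :
  (forall x : R, is_derive x 1 f (f' x)) -> measurable_fun [set: R] f.
Proof.
move=> df; apply: continuous_measurable_fun => x.
apply/differentiable_continuous/derivable1_diffP.
exact: (@ex_derive _ _ _ _ _ _ _ (df x)).
Qed.

Lemma measurable_free_energy (beta h : R) :
  measurable_fun [set: R] (free_energy beta h).
Proof. exact: derivable_measurable (is_derive_free_energy beta h). Qed.

Lemma measurable_plus_prob (beta h : R) :
  measurable_fun [set: R] (plus_prob beta h).
Proof. exact: derivable_measurable (is_derive_plus_prob beta h). Qed.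

Lemma plus_probN (beta h x : R) : plus_prob beta (- h) (- x) = 1 - plus_prob beta
  h x.
Proof.
rewrite /plus_prob mulrN -opprD opprK.
have e0 : 0 < expR (beta * x + h) + expR (- (beta * x + h)).
  by rewrite addr_gt0 ?expR_gt0.
by rewrite [in LHS](addrC (expR _)); field; rewrite gt_eqF.
Qed.

Lemma free_energyN (beta h x : R) : free_energy beta (- h) (- x) = free_energy
  beta h x.
Proof.
by rewrite /free_energy /log_partition mulrN -opprD opprK sqrrN [in LHS](addrC
  (expR _)).
Qed.

(** Changing the sign of [x] and of the field exchanges the two spin values. *)
Lemma mixture_integralN (N k j : nat) (beta h : R) (X : set R) :
  measurable X -> (j <= k)%N ->
  \int[mu]_x (binomial_pmf k (plus_prob beta (- h) x) j *
    mixing_weight (free_energy beta (- h)) X N x) =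
  \int[mu]_x (binomial_pmf k (plus_prob beta h x) (k - j) *
    mixing_weight (free_energy beta h) (-%R @^-1` X) N x).
Proof.
move=> mX jk; rewrite (@Rintegral_affine _ (-1) 0).
- rewrite normrN1 mul1r; apply: eq_Rintegral => x _.
  rewrite mulN1r addr0 /mixing_weight plus_probN free_energyN binomial_pmf_onem//.
- by rewrite oppr_eq0 oner_neq0.
- apply: measurable_funM.
    exact: (measurableT_comp (@measurable_binomial_pmf R setT k j)
      (measurable_plus_prob _ _)).
  by apply: measurable_mixing_weight => //; exact: measurable_free_energy.
- move=> x; rewrite mulr_ge0 ?mixing_weight_ge0// binomial_pmf_ge0//.
  by case/andP: (plus_prob01 beta (- h) x) => ? ?; rewrite !ltW.
Qed.

End gibbs_mixture.

(** * The mean-field equation *)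

Section mean_field.
Context {R : realType}.
Variables (beta h : R).
Hypothesis beta0 : 0 < beta.

Let s (x : R) := tanh (beta * x + h).
Let s' (x : R) := beta * (1 - s x ^+ 2).

Let ds (x : R) : is_derive x 1 s (s' x).
Proof. exact: is_derive_tanh_affine. Qed.

Let s_lt x y : x < y -> s x < s y.
Proof. by move=> xy; apply: tanh_increasing; rewrite ltrD2r ltr_pM2l. Qed.

(** The second derivative of the free energy is [beta * (1 - s' y)], which is at
    least [beta * delta] between [m] and [x]. *)
Lemma free_energy_ge_local (m x delta : R) : m = s m ->
  (forall y, Num.min m x <= y <= Num.max m x -> s' y <= 1 - delta) ->
  beta * delta / 2 * (x - m) ^+ 2 <= free_energy beta h x - free_energy beta h m.
Proof.
move=> ms sd; have [->|mx] := eqVneq m x; first by rewrite !subrr expr0n/= mulr0.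
pose r y := beta * (y - s y) / (y - m).
have [|y|z /andP[z0 z1] ->] := @quadratic_mvt R
    (fun x => free_energy beta h x - free_energy beta h m) r m x mx.
- by rewrite subrr.
- move=> _; have d1 := is_derive_free_energy beta h y.
  apply: is_derive_eq; rewrite subr0 /r -/(s y).
  have [->|ym] := eqVneq y m; first by rewrite {1}ms !subrr mulr0 mul0r.
  by rewrite [RHS]mulrC divfK// subr_eq0.
have zm : z - m != 0.
  rewrite subr_eq0; apply/eqP => zm.
  by move: z0 z1; rewrite zm gt_min lt_max ltxx/= => ? ?; lra.
have rz : beta * delta <= r z.
  rewrite /r -mulrA ler_pM2l//.
  have -> : z - s z = (z - m) - (s z - s m) by rewrite -ms; ring.
  rewrite mulrBl mulfV// lerBrDl -lerBrDr.
  move: zm; rewrite subr_eq0 neq_lt => /orP[zm|mz].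
    have [y /andP[zy ym] E] := MVT_is_derive zm ds.
    rewrite -[X in X / _]opprB E -[X in _ / X]opprB invrN mulrNN mulfK ?subr_eq0
      ?gt_eqF//.
    by apply: sd; rewrite (ltW (lt_trans z0 zy)) le_max (ltW ym).
  have [y /andP[my yz] E] := MVT_is_derive mz ds.
  rewrite E mulfK ?subr_eq0 ?gt_eqF//.
  by apply: sd; rewrite (ltW (lt_trans yz z1)) ge_min (ltW my).
by rewrite mulrAC; apply: ler_wpM2r => //; apply: ler_wpM2r => //; rewrite sqr_ge0.
Qed.

Section positive_solution.
Hypothesis h0 : 0 <= h.
Variable m : R.
Hypotheses (m0 : 0 < m) (ms : m = s m).

Let s_ge0 x : 0 <= x -> 0 <= s x.
Proof. by move=> x0; apply: tanh_ge0; rewrite addr_ge0// mulr_ge0// ltW. Qed.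

Let s'_lt x y : 0 <= x -> x < y -> s' y < s' x.
Proof.
move=> x0 xy; rewrite /s' ltr_pM2l// ltrD2l ltrN2.
by rewrite ltr_pXn2r ?nnegrE ?s_ge0// ?(ltW (le_lt_trans x0 xy))// s_lt.
Qed.

Let s'_le x y : 0 <= x -> x <= y -> s' y <= s' x.
Proof.
by move=> x0; rewrite le_eqVlt => /predU1P[->//|xy]; rewrite ltW// s'_lt.
Qed.

(** On the half-line [s] is concave. Its mean slope between 0 and [m] is at most
    1 because [0 <= s 0], so its slope falls below 1 strictly before [m]. *)
Let cut : exists2 a, 0 < a < m & s' a < 1.
Proof.
have [xi /andP[xi0 xim] E] := MVT_is_derive m0 ds.
have s1 : s' xi <= 1.
  rewrite -(ler_pM2r m0) mul1r; move: E; rewrite -ms subr0 => <-.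
  by have := s_ge0 (lexx 0); lra.
exists ((xi + m) / 2); first by apply/andP; split; lra.
by apply: lt_le_trans s1; apply: s'_lt; lra.
Qed.

Lemma mean_field_slope_lt1 : beta * (1 - m ^+ 2) < 1.
Proof.
have [a /andP[a0 am] sa] := cut; rewrite [X in X ^+ 2]ms -/(s' m).
by apply: le_lt_trans sa; apply: s'_le; exact: ltW.
Qed.

(** Concavity again: [s] lies above its chord between 0 and [m], which lies above
    the diagonal. *)
Let s_ge_id x : 0 <= x <= m -> x <= s x.
Proof.
move=> /andP[]; rewrite le_eqVlt => /predU1P[<- _|x0]; first exact: s_ge0.
rewrite le_eqVlt => /predU1P[->|xm]; first by rewrite -ms.
rewrite leNgt; apply/negP => sx.
have [x1 /andP[x10 x1x] E1] := MVT_is_derive x0 ds.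
have [x2 /andP[xx2 x2m] E2] := MVT_is_derive xm ds.
have h1 : s' x1 < 1.
  rewrite -(ltr_pM2r x0) mul1r; move: E1; rewrite subr0 => <-.
  by have := s_ge0 (lexx 0); lra.
have h2 : 1 < s' x2.
  by rewrite -(@ltr_pM2r _ (m - x)) ?subr_gt0// mul1r -E2 -ms; lra.
have := s'_lt (ltW x10) (lt_trans x1x xx2); lra.
Qed.

Lemma mean_field_above x : m < x -> s x < x.
Proof.
move=> mx; have [a /andP[a0 am] sa] := cut.
have [y /andP[my yx] E] := MVT_is_derive mx ds.
have : s' y < 1 by apply: lt_trans sa; apply: s'_lt;
  [exact: ltW|exact: lt_trans am my].
rewrite -(@ltr_pM2r _ (x - m)) ?subr_gt0// -E mul1r -ms; lra.
Qed.

(** Beyond the point [a] of [cut] the free energy is uniformly convex. Before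
    [a] it decreases, so it stays above its value at [a], while
    [(x - m) ^+ 2 <= m ^+ 2]; this costs the factor [((m - a) / m) ^+ 2]. *)
Lemma free_energy_ge_pos : exists2 c, 0 < c &
  forall x, 0 <= x -> c * (x - m) ^+ 2 <= free_energy beta h x - free_energy beta
    h m.
Proof.
have [a /andP[a0 am] sa] := cut.
pose delta := 1 - s' a; have delta0 : 0 < delta by rewrite subr_gt0.
have far x : a <= x -> beta * delta / 2 * (x - m) ^+ 2 <=
    free_energy beta h x - free_energy beta h m.
  move=> ax; apply: free_energy_ge_local => // y /andP[+ _].
  rewrite ge_min => xy.
  have ay : a <= y by case/orP: xy => [/(le_trans (ltW am))|/(le_trans ax)].
  by rewrite /delta; have := s'_le (ltW a0) ay; lra.
pose t := (m - a) / m.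
have t0 : 0 < t by rewrite divr_gt0// subr_gt0.
have t1 : t <= 1 by rewrite ler_pdivrMr// mul1r; lra.
have bd : 0 < beta * delta / 2 by rewrite divr_gt0// mulr_gt0.
exists (beta * delta / 2 * t ^+ 2); first by rewrite mulr_gt0// exprn_gt0.
move=> x x0; have [ax|xa] := leP a x.
  apply: le_trans (far _ ax); rewrite ler_wpM2r ?sqr_ge0// ler_piMr ?(ltW bd)//.
  by rewrite exprn_ile1// ltW.
have [y /andP[xy ya] E] := MVT_is_derive xa (is_derive_free_energy beta h).
have dec : free_energy beta h a <= free_energy beta h x.
  rewrite -subr_le0 E mulr_le0_ge0 ?subr_ge0 ?(ltW xa)//.
  rewrite mulr_ge0_le0 ?(ltW beta0)// subr_le0.
  by apply: s_ge_id; apply/andP; split; lra.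
apply: (@le_trans _ _ (free_energy beta h a - free_energy beta h m));
  last by rewrite lerD2r.
apply: (le_trans _ (far _ (lexx a))); rewrite -[leLHS]mulrA ler_pM2l//.
rewrite -exprMn -(sqrrN (t * _)) -mulrN opprB -(sqrrN (a - m)) opprB.
have tm : t * (m - x) <= m - a.
  by rewrite -[leRHS](@divfK _ m) ?gt_eqF// ler_wpM2l ?(ltW t0)//; lra.
rewrite ler_pXn2r// nnegrE; first by rewrite mulr_ge0 ?(ltW t0)//; lra.
by rewrite subr_ge0 ltW.
Qed.


(** For [x < 0], compare with the mirror image [a = - x]. The bound at [a] is of
    the required order unless [a] is close to [m], that is [x] to [- m]; there
    the excess [L a] of the free energy of [- a] over that of [a] takes over. It
    is positive since it increases from [L 0 = 0]. *)
Lemma free_energy_ge_line : 0 < h -> exists2 c, 0 < c &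
  forall x, c * (x - m) ^+ 2 <= free_energy beta h x - free_energy beta h m.
Proof.
move=> hp; have [c c0 cP] := free_energy_ge_pos.
pose L x := free_energy beta h (- x) - free_energy beta h x.
have dL (x : R) : is_derive x 1 L
    (beta * (tanh (beta * x + h) - tanh (beta * x - h))).
  have d1 := is_derive_free_energy beta h x.
  have d2 := @is_derive1_comp R _ (fun x => - x) x _ _
    (is_derive_free_energy beta h (- x)) (is_deriveNid x 1).
  have d3 := is_deriveB d2 d1; apply: (is_derive_eq d3).
  by rewrite (_ : beta * - x + h = - (beta * x - h)) ?tanh_opp; ring.
have L'_gt0 x : 0 < beta * (tanh (beta * x + h) - tanh (beta * x - h)).
  by rewrite mulr_gt0// subr_gt0 tanh_increasing//; lra.
have L_lt x y : x < y -> L x < L y.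
  move=> xy; have [z _ E] := MVT_is_derive xy dL.
  by rewrite -subr_gt0 E mulr_gt0 ?subr_gt0.
have L0 : L 0 = 0 by rewrite /L oppr0 subrr.
have m2 : 0 < m / 2 by rewrite divr_gt0.
have Lm : 0 < L (m / 2) by rewrite -L0 L_lt.
have mm : 0 < 9 * m ^+ 2 by rewrite mulr_gt0// exprn_gt0.
exists (Num.min (c / 9) (L (m / 2) / (9 * m ^+ 2))).
  by rewrite lt_min !divr_gt0.
move=> x; set c' := Num.min _ _.
have c'1 : c' <= c / 9 by rewrite ge_min lexx.
have c'2 : c' <= L (m / 2) / (9 * m ^+ 2) by rewrite ge_min lexx orbT.
have sq0 (y : R) : 0 <= y ^+ 2 by exact: sqr_ge0.
have [x0|x0] := leP 0 x.
  apply: le_trans (cP _ x0); apply: ler_wpM2r => //.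
  by apply: (le_trans c'1); lra.
pose a := - x; have a0 : 0 < a by rewrite oppr_gt0.
have -> : free_energy beta h x = free_energy beta h a + L a by rewrite /L /a
  opprK; ring.
have -> : (x - m) ^+ 2 = (a + m) ^+ 2 by rewrite /a; ring.
have La : 0 < L a by rewrite -L0 L_lt.
have ca := cP _ (ltW a0).
(* If [3 * `|a - m| < a + m], then [a] is between [m / 2] and [2 * m]. *)
clearbody a; have [am|am] := leP ((a + m) ^+ 2) (9 * (a - m) ^+ 2).
  apply: (@le_trans _ _ (c / 9 * (9 * (a - m) ^+ 2))).
    apply: ler_pM => //.
    by rewrite /c' le_min !divr_ge0// ltW.
  have -> : c / 9 * (9 * (a - m) ^+ 2) = c * (a - m) ^+ 2 by field.
  lra.
have /andP[a1 a2] : m / 2 < a < 2 * m.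
  apply/andP; split; rewrite ltNge; apply/negP => am'; move: am; apply/negP;
    rewrite -leNgt !expr2; nra.
apply: (@le_trans _ _ (L (m / 2) / (9 * m ^+ 2) * (9 * m ^+ 2))).
  apply: ler_pM => //; first by rewrite /c' le_min !divr_ge0// ltW.
  rewrite !expr2; nra.
rewrite divfK ?gt_eqF//; have := L_lt _ _ a1.
have := mulr_ge0 (ltW c0) (sq0 (a - m)); lra.
Qed.

End positive_solution.

Lemma free_energy_ge_high_temperature : h = 0 -> beta < 1 -> forall x,
  beta * (1 - beta) / 2 * x ^+ 2 <= free_energy beta h x - free_energy beta h 0.
Proof.
move=> hE beta1 x; rewrite -[x in x ^+ 2]subr0; apply: free_energy_ge_local.
  by rewrite /s hE mulr0 addr0 tanh0.
move=> y _; rewrite opprB addrCA subrr addr0 /s' -[leRHS]mulr1 ler_pM2l//.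
by rewrite gerBl sqr_ge0.
Qed.

(** The intermediate value theorem between 1 and a point where [s] is above the
    diagonal: 0 itself in a positive field; without field, a small positive
    number, because the slope of [s] at 0 is [beta]. *)
Lemma positive_solution_exists : 0 < h \/ (h = 0 /\ 1 < beta) ->
  exists2 m : R, 0 < m & m = tanh (beta * m + h).
Proof.
move=> H.
have [x x0 sx] : exists2 x : R, 0 <= x & x < s x.
  case: H => [hp|[hE beta1]].
    by exists 0 => //; rewrite /s mulr0 add0r -tanh0 tanh_increasing.
  have s0 : s 0 = 0 by rewrite /s hE mulr0 addr0 tanh0.
  have xn0 : (@harmonic R) n @[n --> \oo] --> 0 by exact: cvg_harmonic.
  have xN0 : \forall n \near \oo, harmonic n != (0 : R).
    by apply: nearW => n; rewrite /harmonic invr_neq0.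
  have q := diff_quotient_cvg (ds 0) xn0 xN0.
  have b1 : 1 < s' 0 by rewrite /s' s0 expr0n/= subr0 mulr1.
  have [N _ /(_ N (leqnn N))] := cvgr_gt _ q _ b1.
  rewrite /= s0 !subr0 => h1; have hN : 0 < (@harmonic R) N by exact: harmonic_gt0.
  exists (harmonic N); first exact: ltW.
  by move: h1; rewrite ltr_pdivlMr ?mul1r.
have sx1 : s x < 1 by exact: tanh_lt1.
have x1 : x < 1 by exact: lt_trans sx sx1.
have cg : continuous (fun y => y - s y).
  move=> y; apply/differentiable_continuous/derivable1_diffP.
  by apply: derivableB => //; exact: (@ex_derive _ _ _ _ _ _ _ (ds y)).
have [|y] := @IVT R (fun y => y - s y) x 1 0 (ltW x1) (continuous_subspaceT cg).
  have s1 : s 1 < 1 by exact: tanh_lt1.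
  by rewrite ge_min le_max; apply/andP; split; apply/orP; [left|right]; lra.
rewrite in_itv/= => /andP[xy _] E; exists y; last by apply/eqP; rewrite -subr_eq0 E.
rewrite lt_neqAle (le_trans x0 xy) andbT; apply/negP => /eqP y0.
have xE : x = 0 by apply/eqP; rewrite eq_le x0 andbT y0.
by move: E sx; rewrite -y0 -xE; lra.
Qed.

Lemma positive_solution_magnetization m : 0 <= h -> 0 < m ->
  m = tanh (beta * m + h) -> is_magnetization beta h m.
Proof.
move=> h0 m0 ms; split => // [y ys|_]; last exact: ltW.
rewrite (gtr0_norm m0); have [y0|y0] := leP 0 y.
  rewrite leNgt ger0_norm//; apply/negP => /(mean_field_above h0 m0 ms).
  by rewrite /s -ys ltxx.
rewrite ltr0_norm// leNgt; apply/negP => my.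
have := mean_field_above h0 m0 ms my; rewrite /s [X in _ < - X]ys -tanh_opp.
apply/negP; rewrite -leNgt.
have [->|hN0] := eqVneq h 0; first by rewrite !addr0 mulrN.
have hp : 0 < h by rewrite lt_neqAle eq_sym hN0.
by apply/ltW/tanh_increasing; lra.
Qed.

(** In a positive field, the mirror image of a negative solution is a point where
    [s] is above the diagonal, so it is smaller than the positive solution. *)
Lemma is_magnetization_gt0 m : 0 < h \/ (h = 0 /\ 1 < beta) ->
  is_magnetization beta h m -> 0 < m.
Proof.
move=> H [mE mmax mh0].
have [m1 m10 m1E] := positive_solution_exists H.
have := mmax _ m1E; rewrite (gtr0_norm m10) => m1m.
have mN0 : m != 0 by rewrite -normr_gt0 (lt_le_trans m10).
case: H => [hp|[hE _]]; last by rewrite lt_neqAle eq_sym mN0 mh0.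
rewrite ltNge; apply/negP => mle0.
have mlt0 : m < 0 by rewrite lt_neqAle mN0.
rewrite ltr0_norm// in m1m.
have sle : s (- m) <= - m.
  move: m1m; rewrite le_eqVlt => /predU1P[<-|]; first by rewrite /s -m1E.
  by move=> /(mean_field_above (ltW hp) m10 m1E)/ltW.
move: sle; rewrite leNgt => /negP; apply.
rewrite [ltLHS](_ : _ = tanh (beta * - m - h)).
  by apply: tanh_increasing; lra.
by rewrite {1}mE -tanh_opp; congr tanh; ring.
Qed.

Lemma is_magnetizationN m : h != 0 ->
  is_magnetization beta h m -> is_magnetization beta (- h) (- m).
Proof.
move=> h0 [mE mmax _]; split.
- by rewrite {1}mE -tanh_opp; congr tanh; ring.
- move=> y yE; rewrite normrN -(normrN y); apply: mmax.
  by rewrite {1}yE -tanh_opp; congr tanh; ring.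
- by move/eqP; rewrite oppr_eq0 (negbTE h0).
Qed.

End mean_field.

Section magnetization.
Context {R : realType}.
Implicit Types beta h : R.

Lemma magnetizationP_pos beta h : 0 < beta ->
  0 < h \/ (h = 0 /\ 1 < beta) ->
  is_magnetization beta h (magnetization beta h).
Proof.
move=> beta0 H; apply: (@xgetPex _ 0 [set z | is_magnetization beta h z]).
have [m m0 mE] := positive_solution_exists H.
exists m; apply: positive_solution_magnetization => //.
by case: H => [/ltW//|[-> _]].
Qed.

Lemma magnetizationP_neg beta h : 0 < beta -> h < 0 ->
  is_magnetization beta h (magnetization beta h).
Proof.
move=> beta0 hn; apply: (@xgetPex _ 0 [set z | is_magnetization beta h z]).
have hN : 0 < - h by rewrite oppr_gt0.
exists (- magnetization beta (- h)); rewrite /= -[h in X in X _]opprK.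
apply: is_magnetizationN; first by rewrite gt_eqF.
by apply: magnetizationP_pos => //; left.
Qed.

End magnetization.

(** * Limits of the total variation distance *)

Section mixture_mass.
Context {R : realType}.
Local Notation mu := (@lebesgue_measure R).
Variables (psi p : R -> R) (X : set R) (N k : nat).
Hypotheses (mpsi : measurable_fun [set: R] psi) (mX : measurable X)
  (mp : measurable_fun [set: R] p) (p01 : forall x, 0 < p x < 1).

Let pmf_ge0 j x : 0 <= binomial_pmf k (p x) j.
Proof. by apply: binomial_pmf_ge0; case/andP: (p01 x) => ? ?; rewrite !ltW. Qed.

Let mw := measurable_mixing_weight N mpsi mX.

Lemma mixture_pmf_ge0 j : 0 <= mixture_pmf psi p X N k j.
Proof.
by rewrite divr_ge0// Rintegral_ge0// => x _; rewrite ?mulr_ge0 ?mixing_weight_ge0.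
Qed.

Lemma integrable_mixture j :
  mu.-integrable [set: R] (EFin \o mixing_weight psi X N) ->
  mu.-integrable [set: R]
    (EFin \o (fun x => binomial_pmf k (p x) j * mixing_weight psi X N x)).
Proof.
move=> iw; apply: (le_integrable measurableT _ _ iw).
  apply/measurable_EFinP; apply: measurable_funM => //.
  exact: (measurableT_comp (@measurable_binomial_pmf R setT k j) mp).
move=> x _; rewrite lee_fin/= !ger0_norm ?mulr_ge0 ?mixing_weight_ge0//.
rewrite ler_piMl ?mixing_weight_ge0//.
have [jk|kj] := leqP j k; last by rewrite /binomial_pmf bin_small.
rewrite -(sum_binomial_pmf k (p x)) (bigD1 (Ordinal (jk : (j < k.+1)%N)))//=.
by rewrite lerDl sumr_ge0.
Qed.

(** The sum is 1 when the mixing weight has a finite positive integral. In the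
    other cases, such as [N = 0] on the whole line, real-valued integration and
    division make all terms 0. *)
Lemma sum_mixture_pmf_le1 : \sum_(j < k.+1) mixture_pmf psi p X N k j <= 1.
Proof.
have [iw|Niw] := pselect (mu.-integrable [set: R] (EFin \o mixing_weight psi X N)).
  rewrite -mulr_suml -Rintegral_sum => [|j]; last exact: integrable_mixture.
  under eq_Rintegral do rewrite -mulr_suml sum_binomial_pmf mul1r.
  by have [->|I0] := eqVneq (\int[mu]_x mixing_weight psi X N x) 0;
    rewrite ?mul0r// divff.
have -> : \sum_(j < k.+1) mixture_pmf psi p X N k j = 0; last exact: ler01.
apply: big1 => j _; rewrite /mixture_pmf.
have -> : \int[mu]_x mixing_weight psi X N x = 0; last by rewrite invr0 mulr0.
rewrite /Rintegral.
have := leey (\int[mu]_x (mixing_weight psi X N x)%:E);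
  rewrite le_eqVlt => /predU1P[->//|oo].
exfalso; apply: Niw; apply/integrableP; split; first exact/measurable_EFinP.
under eq_integral => x _ do rewrite /= ger0_norm ?mixing_weight_ge0//.
exact: oo.
Qed.

End mixture_mass.

Section phases.
Context {R : realType}.
Local Notation mu := (@lebesgue_measure R).
Variables (k : nat -> nat) (alpha : R).
Hypotheses (koo : k @ \oo --> \oo)
  (kalpha : ((k n)%:R / n%:R : R) @[n --> \oo] --> alpha)
  (kn : forall n, (0 < n)%N -> (k n <= n)%N).

(** The variance in [mixture_llt] when [psi] is the free energy. *)
Definition fluctuation_var (beta m : R) : R :=
  (1 - m ^+ 2) / 4 *
  (1 + alpha * beta * (1 - m ^+ 2) / (1 - beta * (1 - m ^+ 2))).

Lemma mixture_local_limit (beta h m c : R) (X : set R) :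
  0 < beta -> m = tanh (beta * m + h) -> beta * (1 - m ^+ 2) < 1 ->
  measurable X -> nbhs m X -> 0 < c ->
  (forall x, X x -> c * (x - m) ^+ 2 <= free_energy beta h x - free_energy beta h
    m) ->
  local_limit k ((1 + m) / 2)
    (fun n => mixture_pmf (free_energy beta h) (plus_prob beta h) X n (k n))
    (normal_pdf 0 (Num.sqrt (fluctuation_var beta m))).
Proof.
move=> beta0 mE slope mX Xm c0 cP j t jt.
have pm : plus_prob beta h m = (1 + m) / 2 by rewrite plus_prob_tanh -mE.
have kappa0 : 0 < beta * (1 - beta * (1 - m ^+ 2)) by rewrite mulr_gt0// subr_gt0.
have d1 := is_derive_tanh_affine beta h m; rewrite -mE in d1.
have ddpsi : is_derive m 1 (fun x => beta * (x - tanh (beta * x + h)))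
    (beta * (1 - beta * (1 - m ^+ 2))).
  by apply: is_derive_eq; rewrite /GRing.scale/=; ring.
have dp := is_derive_plus_prob beta h m; rewrite -mE in dp.
have := @mixture_llt R (free_energy beta h) _ (plus_prob beta h) X m _ c _
  (is_derive_free_energy beta h) _ ddpsi kappa0 mX Xm c0 cP
  (measurable_plus_prob beta h) (plus_prob01 beta h) dp k j alpha t koo kalpha.
rewrite pm /= -mE subrr mulr0 => /(_ erefl jt).
have -> // : (1 + m) / 2 * (1 - (1 + m) / 2) + alpha * (beta * (1 - m ^+ 2) / 2)
  ^+ 2 /
   (beta * (1 - beta * (1 - m ^+ 2))) = fluctuation_var beta m.
rewrite /fluctuation_var; field.
by rewrite (gt_eqF beta0)/= gt_eqF// subr_gt0.
Qed.

Lemma binomial_local_limit (p : R) : 0 < p < 1 ->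
  local_limit k p (fun n => binomial_pmf (k n) p)
    (normal_pdf 0 (Num.sqrt (p * (1 - p)))).
Proof.
move=> p01 j t jt; rewrite -[t in X in _ --> X]subr0.
apply: binomial_llt => //; first by move=> _; case/andP: p01 => ? ?; rewrite !ltW.
rewrite subrr; under eq_fun do rewrite mulr0.
exact: cvg_cst.
Qed.

Let Rintegral_normal_pdf v : \int[mu]_t normal_pdf 0 (Num.sqrt v) t = 1 :> R.
Proof. by rewrite /Rintegral integral_normal_pdf. Qed.

Lemma normal_l1_dist (p : R) (V v : R) (a b : nat -> nat -> R) : 0 < p < 1 ->
  (forall n j, 0 <= a n j) -> (forall n j, 0 <= b n j) ->
  (forall n, \sum_(j < (k n).+1) a n j <= 1) ->
  (forall n, \sum_(j < (k n).+1) b n j <= 1) ->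
  local_limit k p a (normal_pdf 0 (Num.sqrt V)) ->
  local_limit k p b (normal_pdf 0 (Num.sqrt v)) ->
  2^-1 * \sum_(j < (k n).+1) `|a n j - b n j| @[n --> \oo] --> D V v.
Proof.
move=> p01 a0 b0 a1 b1 alim blim; apply: cvgM; first exact: cvg_cst.
apply: (local_limit_l1_dist koo p01 a0 b0 a1 b1 _ _ _ _ _ _ alim blim) => //.
- by move=> t; exact: normal_pdf_ge0.
- by move=> t; exact: normal_pdf_ge0.
- exact: integrable_normal_pdf.
- exact: integrable_normal_pdf.
Qed.

Let near_n : \forall n \near \oo, (0 < n)%N /\ (k n <= n)%N.
Proof. by exists 1%N => // n /= n0; split => //; exact: kn. Qed.

Lemma single_phase_limit (beta h m c : R) :
  0 < beta -> m = tanh (beta * m + h) -> beta * (1 - m ^+ 2) < 1 -> 0 < c ->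
  (forall x, c * (x - m) ^+ 2 <= free_energy beta h x - free_energy beta h m) ->
  dTV (plus_count_law n (k n) beta h) (Bin (k n) ((1 + m) / 2)) @[n --> \oo] -->
  D (fluctuation_var beta m) ((1 - m ^+ 2) / 4).
Proof.
move=> beta0 mE slope c0 cP.
have m1 : -1 < m < 1 by rewrite mE tanh_lt1 tanh_gtN1.
have p01 : 0 < (1 + m) / 2 < 1 by case/andP: m1 => ? ?; apply/andP; split; lra.
have p01' : 0 <= (1 + m) / 2 <= 1 by case/andP: p01 => ? ?; rewrite !ltW.
have pq : (1 + m) / 2 * (1 - (1 + m) / 2) = (1 - m ^+ 2) / 4 by field.
have lim : 2^-1 * \sum_(j < (k n).+1) `|count_pmf n (k n) beta h j -
    binomial_pmf (k n) ((1 + m) / 2) j| @[n --> \oo] -->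
    D (fluctuation_var beta m) ((1 - m ^+ 2) / 4).
  apply: (@normal_l1_dist _ _ _ (fun n => count_pmf n (k n) beta h)
    (fun n => binomial_pmf (k n) ((1 + m) / 2)) p01).
  - by move=> n j; exact: count_pmf_ge0.
  - by move=> n j; exact: binomial_pmf_ge0.
  - by move=> n; rewrite sum_count_pmf.
  - by move=> n; rewrite sum_binomial_pmf.
  - move=> j t jt.
    have mT : nbhs m [set: R] by exact: filterT.
    have := @mixture_local_limit beta h m c setT beta0 mE slope measurableT
      mT c0 (fun x _ => cP x) j t jt.
    apply: cvg_trans; apply: near_eq_cvg; near=> n.
    have [n0 knn] : (0 < n)%N /\ (k n <= n)%N by near: n.
    by rewrite count_pmf_mixture.
  - by rewrite -pq; exact: binomial_local_limit.
apply: cvg_trans lim; apply: near_eq_cvg; apply: nearW => n.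
rewrite (dTV_lattice (plus_count_law_lattice n (k n) beta h) (Bin_lattice _
  p01'))//.
by rewrite sum_count_pmf sum_binomial_pmf.
Unshelve. all: by end_near. Qed.


Let near_upper_half (p t : R) (j : nat -> nat) : 2^-1 < p ->
  Num.sqrt (k n)%:R * ((j n)%:R / (k n)%:R - p) @[n --> \oo] --> t ->
  \forall n \near \oo, (k n < (j n).*2)%N.
Proof.
move=> p2 jt; have jp := cvg_of_scaled (cvg_sqrtn koo) jt.
near=> n.
have : 2^-1 < (j n)%:R / (k n)%:R :> R by near: n; exact: (cvgr_gt _ jp).
have k0 : (0 : R) < (k n)%:R by rewrite ltr0n; near: n; have /cvgnyPgt := koo;
  apply.
rewrite ltr_pdivlMr// -(ltr_pM2l (@ltr0n R 2)) mulrA divff// mul1r -natrM ltr_nat.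
by rewrite mul2n.
Unshelve. all: by end_near. Qed.

(** The restriction of [a] to the upper half of the lattice has the same local
    limit, hence it has full mass in the limit. *)
Let lower_half_mass (p V : R) (a : nat -> nat -> R) : 2^-1 < p < 1 ->
  (forall n j, 0 <= a n j) -> (forall n, \sum_(j < (k n).+1) a n j <= 1) ->
  local_limit k p a (normal_pdf 0 (Num.sqrt V)) ->
  \sum_(j < (k n).+1 | (j.*2 <= k n)%N) a n j @[n --> \oo] --> 0.
Proof.
move=> /andP[p2 p1] a0 a1 alim.
pose a' n j := if (j.*2 <= k n)%N then 0 else a n j.
have a'0 n j : 0 <= a' n j by rewrite /a'; case: ifP.
have split_sum n : \sum_(j < (k n).+1) a n j =
    \sum_(j < (k n).+1 | (j.*2 <= k n)%N) a n j + \sum_(j < (k n).+1) a' n j.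
  rewrite (bigID (fun j : 'I_(k n).+1 => (j.*2 <= k n)%N))/=; congr (_ + _).
  by rewrite big_mkcond/=; apply: eq_bigr => j _; rewrite /a'; case: (_ <= _)%N.
have lo0 n : 0 <= \sum_(j < (k n).+1 | (j.*2 <= k n)%N) a n j by exact: sumr_ge0.
have p01 : 0 < p < 1 by apply/andP; split => //; lra.
have a'1 n : \sum_(j < (k n).+1) a' n j <= 1.
  by apply: le_trans (a1 n); rewrite split_sum lerDr.
have a'lim : local_limit k p a' (normal_pdf 0 (Num.sqrt V)).
  move=> j t jt; have := alim j t jt; apply: cvg_trans; apply: near_eq_cvg;
    near=> n.
  by rewrite /a' leqNgt; have -> : (k n < (j n).*2)%N by near: n;
    exact: near_upper_half jt.
have mass := local_limit_mass koo p01 a'0 a'1 (fun t => normal_pdf_ge0 0 _ t)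
  (integrable_normal_pdf 0 _) (Rintegral_normal_pdf V) a'lim.
apply: (@squeeze_cvgr _ _ _ _ (cst 0) (fun n => 1 - \sum_(j < (k n).+1) a' n j)).
- by apply: nearW => n; rewrite lo0/=; have := a1 n; rewrite split_sum; lra.
- exact: cvg_cst.
- by rewrite -[X in _ --> X](subrr (1 : R)); apply: cvgB => //; exact: cvg_cst.
Unshelve. all: by end_near. Qed.

Let sum_rev (n : nat) (F : nat -> R) :
  \sum_(j < n.+1) F (n - j)%N = \sum_(j < n.+1) F j.
Proof.
rewrite (reindex_inj rev_ord_inj)/=; apply: eq_bigr => j _.
by rewrite subSS subKn// -ltnS.
Qed.

(** When [a] and [b] have little mass on the lower half, [a j - b j] and
    [a (n - j) - b (n - j)] are never both sizeable, so adding their mirror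
    images to [a] and [b] nearly doubles the distance between them. *)
Let symmetrized_l1 (n : nat) (a b : nat -> R) :
  (forall j, 0 <= a j) -> (forall j, 0 <= b j) ->
  `| \sum_(j < n.+1) `|(a j + a (n - j)%N) - (b j + b (n - j)%N)|
     - 2 * \sum_(j < n.+1) `|a j - b j| | <=
  4 * (\sum_(j < n.+1 | (j.*2 <= n)%N) a j + \sum_(j < n.+1 | (j.*2 <= n)%N) b j).
Proof.
move=> a0 b0.
pose e j := `|a j - b j|; pose lo j := if (j.*2 <= n)%N then a j + b j else 0.
have -> : \sum_(j < n.+1 | (j.*2 <= n)%N) a j + \sum_(j < n.+1 | (j.*2 <= n)%N) b
  j =
    \sum_(j < n.+1) lo j.
  by rewrite -big_split/= big_mkcond.
have -> : 4 * \sum_(j < n.+1) lo j = \sum_(j < n.+1) 2 * (lo j + lo (n - j)%N).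
  by rewrite -mulr_sumr big_split/= (sum_rev n lo); ring.
have -> : 2 * \sum_(j < n.+1) `|a j - b j| = \sum_(j < n.+1) (e j + e (n - j)%N).
  by rewrite big_split/= (sum_rev n e) mulr_natl mulr2n.
rewrite -sumrB; apply: (le_trans (ler_norm_sum _ _ _)); apply: ler_sum => j _.
have jn : (j <= n)%N by rewrite -ltnS.
have e_lo i : (i.*2 <= n)%N -> e i <= lo i.
  move=> ilo; rewrite /lo ilo /e; apply: (le_trans (ler_normB _ _)).
  by rewrite !ger0_norm.
have lo_ge0 i : 0 <= lo i by rewrite /lo; case: ifP => // _; rewrite addr_ge0.
have uv (u v : R) : `| `|u + v| - (`|u| + `|v|) | <= 2 * `|u|.
  rewrite ler_norml; have := ler_normD u v; have := ler_normB (u + v) u.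
  rewrite addrAC subrr add0r => ? ?; have := normr_ge0 u.
  by move=> ?; apply/andP; split; lra.
have -> : a j + a (n - j)%N - (b j + b (n - j)%N) =
  (a j - b j) + (a (n - j)%N - b (n - j)%N) by ring.
have [jlo|jhi] := leqP j.*2 n.
  apply: (le_trans (uv _ _)); rewrite ler_pM2l//.
  by apply: (le_trans (e_lo _ jlo)); rewrite lerDl.
have jlo' : ((n - j).*2 <= n)%N.
  by rewrite -(leq_add2r j.*2) -doubleD subnK// -addnn leq_add2l ltnW.
rewrite (addrC (a j - b j)) (addrC (e j)); apply: (le_trans (uv _ _));
  rewrite ler_pM2l//.
by apply: (le_trans (e_lo _ jlo')); rewrite lerDr.
Qed.


Let half_line := `[(0 : R), +oo[%classic.

Let integrable_half_weight (N : nat) (beta : R) : (0 < N)%N -> 0 < beta ->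
  forall X : set R, measurable X ->
  mu.-integrable [set: R] (EFin \o mixing_weight (free_energy beta 0) X N).
Proof.
move=> N0 beta0 X mX.
apply: (le_integrable measurableT _ _ (integrable_mixing_weight 0 N0 beta0)).
  apply/measurable_EFinP; apply: measurable_mixing_weight => //.
  exact: measurable_free_energy.
move=> x _; rewrite lee_fin/= !ger0_norm ?mixing_weight_ge0//.
by rewrite /mixing_weight ler_wpM2l ?expR_ge0// !indicE in_setT; case: (_ \in _).
Qed.

(** The part of the integral over the negative half-line is reflected. *)
Let fold_integral (N n j : nat) (beta : R) : (0 < N)%N -> (j <= n)%N -> 0 < beta ->
  let I j X := \int[mu]_x (binomial_pmf n (plus_prob beta 0 x) j *
    mixing_weight (free_energy beta 0) X N x) in
  I j setT = I j half_line + I (n - j)%N half_line.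
Proof.
move=> N0 jn beta0 I.
have mH : measurable half_line by exact: measurable_itv.
have iI i X : measurable X -> mu.-integrable [set: R]
    (EFin \o (fun x => binomial_pmf n (plus_prob beta 0 x) i *
      mixing_weight (free_energy beta 0) X N x)).
  move=> mX; apply: integrable_mixture => //.
  - exact: measurable_free_energy.
  - exact: measurable_plus_prob.
  - exact: plus_prob01.
  - exact: integrable_half_weight.
have -> : I j setT = I j half_line + I j (~` half_line).
  rewrite /I -RintegralD//; last 2 first.
  - exact: iI.
  - by apply: iI; exact: measurableC.
  apply: eq_Rintegral => x _; rewrite -mulrDr /mixing_weight -mulrDr !indicE
    in_setT in_setC.
  by case: (_ \in _); rewrite ?addr0 ?add0r.
congr (_ + _); rewrite /I -[X in free_energy beta X]oppr0 -[X in plus_prob beta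
  X]oppr0.
rewrite mixture_integralN//; last exact: measurableC.
rewrite oppr0.
have -> : -%R @^-1` (~` half_line) = `]0, +oo[%classic.
  by apply/seteqP; split => x; rewrite /half_line /= !in_itv/= !andbT;
    [move/negP; lra|move=> x0; apply/negP; lra].
pose f x := binomial_pmf n (plus_prob beta 0 x) (n - j) *
  expR (- (N%:R * free_energy beta 0 x)).
have fE (A : set R) : \int[mu]_x (binomial_pmf n (plus_prob beta 0 x) (n - j) *
    mixing_weight (free_energy beta 0) A N x) = \int[mu]_(x in A) f x.
  rewrite [RHS]Rintegral_mkcond; apply: eq_Rintegral => x _.
  rewrite patchE /mixing_weight indicE /f; case: (_ \in _); first by rewrite mulr1.
  by rewrite !mulr0.
rewrite !fE Rintegral_itv_obnd_cbnd//.
apply: (integrableS measurableT) => //.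
apply: eq_integrable (iI (n - j)%N setT measurableT) => // x _.
by rewrite /= /f /mixing_weight indicE in_setT mulr1.
Qed.

Let count_pmf_fold (N n j : nat) (beta : R) :
  (0 < N)%N -> (n <= N)%N -> (j <= n)%N -> 0 < beta ->
  let A := mixture_pmf (free_energy beta 0) (plus_prob beta 0) half_line N n in
  count_pmf N n beta 0 j = 2^-1 * (A j + A (n - j)%N).
Proof.
move=> N0 nN jn beta0 A; rewrite count_pmf_mixture// /A /mixture_pmf.
have pmf0 x : binomial_pmf 0 (plus_prob beta 0 x) 0 = 1.
  by rewrite binomial_pmfE !expr0 mul1r.
have := @fold_integral N 0 0 beta N0 (leqnn 0) beta0.
rewrite /= subn0.
under eq_Rintegral do rewrite pmf0 mul1r.
under [X in _ = X + _]eq_Rintegral do rewrite pmf0 mul1r.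
under [X in _ = _ + X]eq_Rintegral do rewrite pmf0 mul1r.
move=> ->; rewrite (@fold_integral N n j beta N0 jn beta0) /=.
have half_div (a b : R) : a / (b + b) = 2^-1 * (a / b).
  by rewrite -mulr2n -(mulr_natl b) invfM mulrCA.
by rewrite half_div mulrDl.
Qed.

(** The Gibbs law of the count is the average of the mixture over the half-line,
    where [m] is the only minimizer of the free energy, and of its mirror image.
    Likewise the mixed binomial law is the average of [Bin (k n) ((1 + m) / 2)]
    and of its mirror image. Since [m] is positive these halves separate, and
    [symmetrized_l1] reduces the claim to a single phase. *)
Lemma two_phase_limit (beta m c : R) :
  0 < beta -> m = tanh (beta * m + 0) -> beta * (1 - m ^+ 2) < 1 -> 0 < m -> 0 <
    c ->
  (forall x, 0 <= x ->
    c * (x - m) ^+ 2 <= free_energy beta 0 x - free_energy beta 0 m) ->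
  dTV (plus_count_law n (k n) beta 0)
    (mixed_Bin (k n) (half_diracs ((1 + m) / 2) ((1 - m) / 2))) @[n --> \oo] -->
  D (fluctuation_var beta m) ((1 - m ^+ 2) / 4).
Proof.
move=> beta0 mE slope m0 c0 cP.
have m1 : m < 1 by rewrite mE tanh_lt1.
set p := (1 + m) / 2.
have p2 : 2^-1 < p < 1 by rewrite /p; apply/andP; split; lra.
have p01 : 0 < p < 1 by case/andP: p2 => ? ?; apply/andP; split => //; lra.
have p01' : 0 <= p <= 1 by case/andP: p01 => ? ?; rewrite !ltW.
have qE : (1 - m) / 2 = 1 - p by rewrite /p; field.
have q01' : 0 <= 1 - p <= 1 by case/andP: p01' => ? ?; apply/andP; split; lra.
have pq : p * (1 - p) = (1 - m ^+ 2) / 4 by rewrite /p; field.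
rewrite qE.
pose A n := mixture_pmf (free_energy beta 0) (plus_prob beta 0) half_line n (k n).
pose B n := binomial_pmf (k n) p.
have mH : measurable half_line by exact: measurable_itv.
have A0 n j : 0 <= A n j by apply: mixture_pmf_ge0 => x; exact: plus_prob01.
have B0 n j : 0 <= B n j by exact: binomial_pmf_ge0.
have A1 n : \sum_(j < (k n).+1) A n j <= 1.
  apply: sum_mixture_pmf_le1 => //;
    [exact: measurable_free_energy|exact: measurable_plus_prob|].
  by move=> x; exact: plus_prob01.
have B1 n : \sum_(j < (k n).+1) B n j <= 1 by rewrite /B sum_binomial_pmf.
have Hm : nbhs m half_line.
  have := lt_nbhsr m0; apply: filterS => x x0.
  by rewrite /half_line /= in_itv/= andbT ltW.
have Alim : local_limit k p A (normal_pdf 0 (Num.sqrt (fluctuation_var beta m))).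
  apply: (@mixture_local_limit beta 0 m c half_line beta0 mE slope mH Hm c0) => x.
  by rewrite /half_line /= in_itv/= andbT; exact: cP.
have Blim : local_limit k p B (normal_pdf 0 (Num.sqrt ((1 - m ^+ 2) / 4))).
  by rewrite -pq; exact: binomial_local_limit.
pose T n := 2^-1 * \sum_(j < (k n).+1) `|A n j - B n j|.
have Tlim : T n @[n --> \oo] --> D (fluctuation_var beta m) ((1 - m ^+ 2) / 4).
  exact: (normal_l1_dist p01 A0 B0 A1 B1 Alim Blim).
pose E n := \sum_(j < (k n).+1 | (j.*2 <= k n)%N) A n j +
  \sum_(j < (k n).+1 | (j.*2 <= k n)%N) B n j.
have E0 : E n @[n --> \oo] --> 0.
  rewrite -[X in _ --> X](addr0 0); apply: cvgD.
    exact: (lower_half_mass p2 A0 A1 Alim).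
  exact: (lower_half_mass p2 B0 B1 Blim).
apply: (@squeeze_cvgr _ _ _ _ (fun n => T n - E n) (fun n => T n + E n)).
- near=> n; have [n0 knn] : (0 < n)%N /\ (k n <= n)%N by near: n.
  rewrite (dTV_lattice (plus_count_law_lattice n (k n) beta 0)
    (mixed_Bin_lattice _ p01' q01')); last first.
    rewrite sum_count_pmf -mulr_sumr big_split/= !sum_binomial_pmf.
    by rewrite -mulr2n mulVf.
  have := @symmetrized_l1 (k n) (A n) (B n) (A0 n) (B0 n).
  set S := \sum_(j < _) _; rewrite -/(E n) => SE.
  have -> : \sum_(j < (k n).+1) `|count_pmf n (k n) beta 0 j -
      2^-1 * (binomial_pmf (k n) p j + binomial_pmf (k n) (1 - p) j)| = 2^-1 * S.
    rewrite mulr_sumr; apply: eq_bigr => j _.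
    have jk : (j <= k n)%N by rewrite -ltnS.
    rewrite (@count_pmf_fold n (k n) j beta n0 knn jk beta0) binomial_pmf_onem//.
    by rewrite -mulrBr normrM ger0_norm.
  move: SE; rewrite ler_norml /T => /andP[? ?]; apply/andP; split; lra.
- by rewrite -[X in _ --> X]subr0; exact: cvgB.
- by rewrite -[X in _ --> X]addr0; exact: cvgD.
Unshelve. all: by end_near. Qed.

End phases.

Section conclusion.
Context {R : realType}.

Lemma D_refl (v : R) : D v v = 0.
Proof.
rewrite /D; under eq_Rintegral do rewrite subrr normr0.
by rewrite Rintegral_cst// mul0r mulr0.
Qed.

Lemma littleo_ratio_cvg0 (k : nat -> nat) :
  ((fun N : nat => (k N)%:R : R^o) =o_\oo (fun N : nat => N%:R : R^o)) ->
  ((k n)%:R / n%:R : R) @[n --> \oo] --> 0.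
Proof.
move=> /eqoP ko; apply/cvgrPdist_le => e e0.
have := ko e e0; apply: filterS => n.
rewrite /= !normr_nat sub0r normrN ger0_norm ?divr_ge0// => h.
have [->|n0] := eqVneq n 0%N; first by rewrite invr0 mulr0 ltW.
by rewrite ler_pdivrMr// ltr0n lt0n.
Qed.

Lemma free_energy_ge_line_neg (beta h m : R) : 0 < beta -> h < 0 -> 0 < - m ->
  m = tanh (beta * m + h) -> exists2 c, 0 < c & forall x,
    c * (x - m) ^+ 2 <= free_energy beta h x - free_energy beta h m.
Proof.
move=> beta0 hn m0 mE.
have hN : 0 < - h by rewrite oppr_gt0.
have mNE : - m = tanh (beta * - m + - h).
  by rewrite {1}mE -tanh_opp; congr tanh; ring.
have [c c0 cP] := free_energy_ge_line beta0 (ltW hN) m0 mNE hN.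
exists c => // x; have := cP (- x); rewrite !free_energyN.
by rewrite -opprD sqrrN.
Qed.

Lemma field_phase (beta h : R) : 0 < beta -> h != 0 ->
  let m := magnetization beta h in
  [/\ m = tanh (beta * m + h), beta * (1 - m ^+ 2) < 1 & exists2 c, 0 < c &
    forall x, c * (x - m) ^+ 2 <= free_energy beta h x - free_energy beta h m].
Proof.
move=> beta0 h0 m; move: (h0); rewrite neq_lt => /orP[hn|hp]; last first.
  have mP := magnetizationP_pos beta0 (or_introl hp).
  have m0 := is_magnetization_gt0 beta0 (or_introl hp) mP.
  have [mE _ _] := mP; split => //.
    exact: (mean_field_slope_lt1 beta0 (ltW hp) m0 mE).
  exact: (free_energy_ge_line beta0 (ltW hp) m0 mE hp).
have mP := magnetizationP_neg beta0 hn; have [mE _ _] := mP.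
have hN : 0 < - h by rewrite oppr_gt0.
have mNP := is_magnetizationN h0 mP.
have m0 := is_magnetization_gt0 beta0 (or_introl hN) mNP.
have [mNE _ _] := mNP; split => //.
  by have := mean_field_slope_lt1 beta0 (ltW hN) m0 mNE; rewrite sqrrN.
exact: free_energy_ge_line_neg.
Qed.

End conclusion.

Theorem theorem1p1 (R : realType) (k : nat -> nat) (alpha : R)
    (k_range : forall N : nat, (0 < N)%N -> (0 < k N <= N)%N)
    (k_infty : k @ \oo --> \oo)
    (alpha01 : 0 <= alpha <= 1)
    (k_alpha : ((k N)%:R / N%:R : R) @[N --> \oo] --> alpha) :
  [/\
      forall beta : R, 0 < beta < 1 ->
        dTV (plus_count_law N (k N) beta 0) (Bin (k N) 2^-1) @[N --> \oo]
        --> D ((1 - beta + alpha * beta) / (4 * (1 - beta))) 4^-1,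
      forall beta : R, 1 < beta ->
        let m := magnetization beta 0 in
        dTV (plus_count_law N (k N) beta 0)
            (mixed_Bin (k N) (half_diracs ((1 + m) / 2) ((1 - m) / 2)))
          @[N --> \oo]
        --> D ((1 - m ^+ 2) / 4 *
               (1 + alpha * beta * (1 - m ^+ 2) / (1 - beta * (1 - m ^+ 2))))
              ((1 - m ^+ 2) / 4),
      forall beta h : R, h != 0 -> 0 < beta ->
        let m := magnetization beta h in
        dTV (plus_count_law N (k N) beta h) (Bin (k N) ((1 + m) / 2))
          @[N --> \oo]
        --> D ((1 - m ^+ 2) / 4 *
               (1 + alpha * beta * (1 - m ^+ 2) / (1 - beta * (1 - m ^+ 2))))
              ((1 - m ^+ 2) / 4)
    &
      ((fun N : nat => (k N)%:R : R^o) =o_\oo (fun N : nat => N%:R : R^o)) ->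
      [/\ alpha = 0,
          forall beta : R, 0 < beta < 1 ->
            D ((1 - beta + alpha * beta) / (4 * (1 - beta))) 4^-1 = 0,
          forall beta : R, 1 < beta ->
            let m := magnetization beta 0 in
            D ((1 - m ^+ 2) / 4 *
               (1 + alpha * beta * (1 - m ^+ 2) / (1 - beta * (1 - m ^+ 2))))
              ((1 - m ^+ 2) / 4) = 0
        & forall beta h : R, h != 0 -> 0 < beta ->
            let m := magnetization beta h in
            D ((1 - m ^+ 2) / 4 *
               (1 + alpha * beta * (1 - m ^+ 2) / (1 - beta * (1 - m ^+ 2))))
              ((1 - m ^+ 2) / 4) = 0]].
Proof.
have kn n : (0 < n)%N -> (k n <= n)%N by move=> /k_range/andP[].
split.
- move=> beta /andP[beta0 beta1].
  have mE : 0 = tanh (beta * 0 + 0) :> R by rewrite mulr0 addr0 tanh0.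
  have slope : beta * (1 - 0 ^+ 2) < 1 by rewrite expr0n/= subr0 mulr1.
  have c0 : 0 < beta * (1 - beta) / 2 by rewrite divr_gt0// mulr_gt0// subr_gt0.
  have := single_phase_limit k_infty k_alpha kn beta0 mE slope c0.
  rewrite /fluctuation_var expr0n/= addr0 subr0 !mul1r !mulr1.
  have -> : 4^-1 * (1 + alpha * beta / (1 - beta)) =
      (1 - beta + alpha * beta) / (4 * (1 - beta)).
    by field; rewrite gt_eqF// subr_gt0.
  apply=> x; rewrite subr0; exact: free_energy_ge_high_temperature.
- move=> beta beta1 m.
  have beta0 : 0 < beta by exact: lt_trans beta1.
  have H : 0 < 0 :> R \/ (0 = 0 :> R /\ 1 < beta) by right.
  have mP := magnetizationP_pos beta0 H.
  have m0 := is_magnetization_gt0 beta0 H mP; have [mE _ _] := mP.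
  have slope := mean_field_slope_lt1 beta0 (lexx 0) m0 mE.
  have [c c0 cP] := free_energy_ge_pos beta0 (lexx 0) m0 mE.
  exact: (two_phase_limit k_infty k_alpha kn beta0 mE slope m0 c0 cP).
- move=> beta h h0 beta0 m; have [mE slope [c c0 cP]] := field_phase beta0 h0.
  exact: (single_phase_limit k_infty k_alpha kn beta0 mE slope c0 cP).
- move=> /littleo_ratio_cvg0 k0.
  have -> : alpha = 0 by exact: (cvg_unique _ k_alpha k0).
  split => // [beta /andP[beta0 beta1]|beta beta1 m|beta h h0 beta0 m].
  + have -> : (1 - beta + 0 * beta) / (4 * (1 - beta)) = 4^-1.
      by field; rewrite gt_eqF// subr_gt0.
    exact: D_refl.
  + by rewrite !mul0r addr0 mulr1 D_refl.
  + by rewrite !mul0r addr0 mulr1 D_refl.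
Qed.
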